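(* Let $\mathfrak g$ be an indecomposable and symmetrizable Kac-Moody algebra, finitely $\Sigma$-graded with indecomposable grading subalgebra $\mathfrak m$. Then the grading subalgebra $\mathfrak m$ is symmetrizable and the restriction to $\mathfrak m$ of the invariant bilinear form of $\mathfrak g$ is nondegenerate.
   Context: Complex Kac-Moody algebras $\mathfrak g=\mathfrak g(A)$ are associated to generalized Cartan matrices $A=(a_{i,j})_{i,j\in I}$ and (minimal) realizations $(\mathfrak h,\{\alpha_i\},\{\alpha_i^\vee\})$, $\dim\mathfrak h=|I|+\mathrm{corank}(A)$, $\langle\alpha_j,\alpha_i^\vee\rangle=a_{i,j}$; $\mathfrak g$ is symmetrizable if $A$ is, i.e. if $DA$ is symmetric for some invertible diagonal $D$. The invariant bilinear form of $\mathfrak g$ is a nondegenerate $\mathrm{ad}(\mathfrak g)$-invariant symmetric $\mathbb C$-bilinear form $(\cdot,\cdot)$ on $\mathfrak g$ with $(\alpha_i^\vee,h)=\frac{(\alpha_i^\vee,\alpha_i^\vee)}{2}\langle\alpha_i,h\rangle$ for $i\in I$, $h\in\mathfrak h$, and $(\alpha_i^\vee,\alpha_i^\vee)$ a positive rational for all $i$. Finite gradation: for a root system $\Sigma$ of Kac-Moody type, $\mathfrak g$ is finitely $\Sigma$-graded with grading subalgebra $\mathfrak m$ if (i) $\mathfrak m\subset\mathfrak g$ is a subalgebra which is a Kac-Moody algebra whose root system relative to a Cartan subalgebra $\mathfrak a$ of $\mathfrak m$ is $\Sigma$; (ii) $\mathfrak g=\sum_{\gamma\in\Sigma\cup\{0\}}V_\gamma$,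 $V_\gamma=\{x\in\mathfrak g:[a,x]=\langle\gamma,a\rangle x\ \forall a\in\mathfrak a\}$; (iii) every $V_\gamma$ ($\gamma\in\Sigma\cup\{0\}$) is finite dimensional. One assumes $\mathfrak a\subset\mathfrak h$. *)

(* Defs.v *)
From HB Require Import structures.
From mathcomp Require Export all_boot all_order all_algebra.
From mathcomp Require Export reals complex.

Set Implicit Arguments.
Unset Strict Implicit.
Unset Printing Implicit Defensive.
Import GRing.Theory.

Local Open Scope ring_scope.

HB.mixin Record Lmodule_isLie (K : fieldType) L of GRing.Lmodule K L := {
  lie : L -> L -> L;
  lie_linear_l : forall y : L, linear (fun x : L => lie x y);
  lie_linear_r : forall x : L, linear (lie x);
  lie_alternating : forall x : L, lie x x = 0;
  lie_jacobi : forall x y z : L,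
    lie x (lie y z) + lie y (lie z x) + lie z (lie x y) = 0
}.

#[short(type="lieAlgType")]
HB.structure Definition LieAlgebra (K : fieldType) :=
  {L of GRing.Lmodule K L & Lmodule_isLie K L}.

Definition lie_morphism (K : fieldType) (L L' : lieAlgType K) (f : L -> L') :
  Prop := linear f /\ {morph f : x y / lie x y}.

Definition gcm (n : nat) (A : 'M[int]_n) : Prop :=
  [/\ forall i, A i i = 2,
      forall i j, i != j -> A i j <= 0
    & forall i j, A i j = 0 -> A j i = 0].

Definition decomposable (n : nat) (A : 'M[int]_n) : Prop :=
  exists S : {pred 'I_n},
    [/\ exists i, i \in S, exists j, j \notin S
      & forall i j, i \in S -> j \notin S -> A i j = 0 /\ A j i = 0].

Definition indecomposable (n : nat) (A : 'M[int]_n) : Prop := ~ decomposable A.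

Definition symmetrizable (K : fieldType) (n : nat) (A : 'M[int]_n) : Prop :=
  exists D : 'M[K]_n,
    [/\ is_diag_mx D, D \in unitmx
      & (D *m map_mx intr A)^T = D *m map_mx intr A].

Record realization (K : fieldType) (n : nat) (A : 'M[int]_n) := Realization {
  rz_space :> vectType K;
  simple_root : 'I_n -> 'Hom(rz_space, K^o);
  simple_coroot : 'I_n -> rz_space;
  simple_root_free : free [seq simple_root i | i <- enum 'I_n];
  simple_coroot_free : free [seq simple_coroot i | i <- enum 'I_n];
  rz_pairing : forall i j, simple_root j (simple_coroot i) = (A i j)%:~R;
  rz_dim :
    \dim {:rz_space} = (n + (n - \rank (map_mx intr A : 'M[K]_n)))%N
}.

(* The algebra g(A) is presented by h, the e_i, the f_i and the Chevalley-Serre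
   relations (for a symmetrizable A this agrees, by the Gabber-Kac theorem, with
   the quotient by the largest ideal meeting h trivially). For i != j the exponent 1 - a_ij is positive, so that taking its
   absolute value only casts it to nat. *)

Record km_relations (K : fieldType) (n : nat) (A : 'M[int]_n)
    (h : realization K A) (L : lieAlgType K)
    (iota : h -> L) (e f : 'I_n -> L) : Prop := {
  km_cartan_linear : linear iota;
  km_hh : forall x y : h, lie (iota x) (iota y) = 0;
  km_ef : forall i j : 'I_n,
    lie (e i) (f j) = if i == j then iota (simple_coroot h i) else 0;
  km_he : forall (x : h) (i : 'I_n),
    lie (iota x) (e i) = (simple_root h i x : K) *: e i;
  km_hf : forall (x : h) (i : 'I_n),
    lie (iota x) (f i) = - (simple_root h i x : K) *: f i;
  km_serre_e : forall i j : 'I_n, i != j ->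
    iter `|1 - A i j|%N (lie (e i)) (e j) = 0;
  km_serre_f : forall i j : 'I_n, i != j ->
    iter `|1 - A i j|%N (lie (f i)) (f j) = 0
}.

Record kac_moody (K : fieldType) (n : nat) (A : 'M[int]_n)
    (h : realization K A) (g : lieAlgType K) := KacMoody {
  cartan : h -> g;
  chev_e : 'I_n -> g;
  chev_f : 'I_n -> g;
  (* h is regarded as a subspace of g *)
  cartan_inj : injective cartan;
  km_rel : km_relations cartan chev_e chev_f;
  km_universal : forall (L : lieAlgType K) (iota : h -> L) (e f : 'I_n -> L),
    km_relations iota e f ->
    exists2 phi : g -> L,
      [/\ lie_morphism phi,
          forall x, phi (cartan x) = iota x,
          forall i, phi (chev_e i) = e i
        & forall i, phi (chev_f i) = f i]
    & forall psi : g -> L,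
      [/\ lie_morphism psi,
          forall x, psi (cartan x) = iota x,
          forall i, psi (chev_e i) = e i
        & forall i, psi (chev_f i) = f i] -> psi =1 phi
}.

Definition weight_space (K : fieldType) (a : vectType K) (L : lieAlgType K)
    (iota : a -> L) (gamma : 'Hom(a, K^o)) (x : L) : Prop :=
  forall t : a, lie (iota t) x = (gamma t : K) *: x.

Definition root_system (K : fieldType) (a : vectType K) (L : lieAlgType K)
    (iota : a -> L) (gamma : 'Hom(a, K^o)) : Prop :=
  gamma != 0 /\ exists2 x : L, weight_space iota gamma x & x != 0.

Definition finite_dimensional (K : fieldType) (V : lmodType K)
    (S : V -> Prop) : Prop :=
  exists (k : nat) (b : 'I_k -> V),
    (forall i, S (b i)) /\
    forall x, S x -> exists c : 'I_k -> K, x = \sum_(i < k) c i *: b i.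

(* The grading subalgebra is given by a Kac-Moody algebra m with its inclusion
   j into g; its Cartan subalgebra a is the one of the structure Mm. *)

Record finitely_graded (K : fieldType)
    (n : nat) (A : 'M[int]_n) (h : realization K A)
    (g : lieAlgType K) (Mg : kac_moody h g)
    (p : nat) (B : 'M[int]_p) (a : realization K B)
    (m : lieAlgType K) (Mm : kac_moody a m)
    (j : m -> g) (Sigma : 'Hom(a, K^o) -> Prop) : Prop := {
  fg_morphism : lie_morphism j;
  fg_inj : injective j;
  fg_root_system : forall gamma, Sigma gamma <-> root_system (cartan Mm) gamma;
  fg_cartan : forall t : a, exists x : h, j (cartan Mm t) = cartan Mg x;
  fg_sum : forall x : g,
    exists (k : nat) (gamma : 'I_k -> 'Hom(a, K^o)) (v : 'I_k -> g),
      (forall i, (Sigma (gamma i) \/ gamma i = 0) /\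
                 weight_space (j \o cartan Mm) (gamma i) (v i)) /\
      x = \sum_(i < k) v i;
  fg_finite : forall gamma, Sigma gamma \/ gamma = 0 ->
    finite_dimensional (weight_space (j \o cartan Mm) gamma)
}.

Record invariant_form (K : fieldType) (n : nat) (A : 'M[int]_n)
    (h : realization K A) (g : lieAlgType K) (Mg : kac_moody h g)
    (form : g -> g -> K) : Prop := {
  form_linear : forall x : g, scalar (form x);
  form_sym : forall x y : g, form x y = form y x;
  form_invariant : forall x y z : g, form (lie x y) z = form x (lie y z);
  form_nondegenerate : forall x : g, (forall y : g, form x y = 0) -> x = 0;
  form_coroot : forall (i : 'I_n) (x : h),
    let c := cartan Mg (simple_coroot h i) in
    form c (cartan Mg x) = form c c / 2 * (simple_root h i x : K);
  form_coroot_pos : forall i : 'I_n,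
    let c := cartan Mg (simple_coroot h i) in
    exists2 q : rat, 0 < q & form c c = ratr q
}.

(* Main.v *)
(* For each simple root gamma_k of m let c = [e_k, f_k] be its coroot, viewed in
   h, and let S be the set of roots of g whose restriction to a is an integral
   multiple of gamma_k. Finiteness of the gradation makes S finite. A root beta
   of g either satisfies (beta, beta) > 0 or has all its doublings 2^k beta among
   the roots: simple reflections lower its height until it is a multiple of a
   simple root or antidominant, and in the latter case 2 beta is the maximal root
   between beta and 2 beta. Hence the form is positive
   on S, S is stable under its own reflections, and averaging over S gives
   (c, c) = sum_{b in S} b(c)^2 / lambda_b with lambda_b > 0, so (c, c) > 0.
   Therefore (e_k, f_k) > 0 for all k, which symmetrizes B.

   Nondegeneracy on m is then the Gabber-Kac argument. If x is a vector of least
   height, of weight beta, orthogonal to the opposite height, then [f_i, x] = 0 for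
   all i, so integrability makes beta antidominant and (beta, beta) <= 0. The
   truncated Casimir sum_s [u_s, [u^s, .]] over dual bases of the lower heights
   acts on weight beta by 2(rho, beta) - (beta, beta), but kills x; as
   2(rho, beta) > 0 this forces x = 0. *)

From HB Require Import structures.
Require Import Defs.
From mathcomp Require Import boolp zify ring lra.

Set Implicit Arguments.
Unset Strict Implicit.
Unset Printing Implicit Defensive.
Import Order.TTheory GRing.Theory Num.Theory.
Local Open Scope ring_scope.

(** * Lie algebras and subalgebras *)

(** Both algebras are given by the Serre presentation, so no simplicity is available. For [g] the
    nondegenerate form takes its place: a root vector pairs nontrivially with some word, which
    yields opposite root vectors. For [m] nondegeneracy is the claim, so the only thing carried over
    from [g] is the positivity of (e_k, f_k). The elements of S need not be simple roots of [g], and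
    a root vector in [g] need not act nilpotently. The sl2-triples behind the reflections of S are
    therefore built from a root vector and a dual one, and their local nilpotency comes from the
    finiteness of S. The coroot c need not lie in the span of S. Its defect d, on which all of S
    vanishes, centralises f_k, so (c, d) = (e_k, [f_k, d]) = 0 and averaging over S still computes
    (c, c). The scalars are only partially ordered, so each square in a positivity argument needs a
    real base. Here b(c) is an even integer for b in S. *)

Section Lie.
Variables (K : fieldType) (L : lieAlgType K).
Implicit Types x y z : L.

Lemma lieDl x y z : lie (x + y) z = lie x z + lie y z.
Proof. by rewrite -[x]scale1r lie_linear_l !scale1r. Qed.
Lemma lieDr x y z : lie x (y + z) = lie x y + lie x z.
Proof. by rewrite -[y]scale1r lie_linear_r !scale1r. Qed.
Lemma lie0l x : lie 0 x = 0.
Proof. by apply: (addrI (lie 0 x)); rewrite -lieDl !addr0. Qed.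
Lemma lie0r x : lie x 0 = 0.
Proof. by apply: (addrI (lie x 0)); rewrite -lieDr !addr0. Qed.
Lemma lieZl c x y : lie (c *: x) y = c *: lie x y.
Proof. by rewrite -[c *: x]addr0 lie_linear_l lie0l addr0. Qed.
Lemma lieZr c x y : lie x (c *: y) = c *: lie x y.
Proof. by rewrite -[c *: y]addr0 lie_linear_r lie0r addr0. Qed.
Lemma lieNl x y : lie (- x) y = - lie x y.
Proof. by rewrite -scaleN1r lieZl scaleN1r. Qed.
Lemma lieNr x y : lie x (- y) = - lie x y.
Proof. by rewrite -scaleN1r lieZr scaleN1r. Qed.
Lemma lieC x y : lie x y = - lie y x.
Proof.
apply/eqP; rewrite -addr_eq0; apply/eqP.
by have := lie_alternating (x + y); rewrite lieDl !lieDr !lie_alternating add0r addr0.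
Qed.
Lemma lie_suml (I : Type) (r : seq I) (P : pred I) (G : I -> L) y :
  lie (\sum_(i <- r | P i) G i) y = \sum_(i <- r | P i) lie (G i) y.
Proof. by elim/big_rec2: _ => [|i _ x _ <-]; rewrite ?lie0l ?lieDl. Qed.
Lemma lie_sumr (I : Type) (r : seq I) (P : pred I) (G : I -> L) y :
  lie y (\sum_(i <- r | P i) G i) = \sum_(i <- r | P i) lie y (G i).
Proof. by elim/big_rec2: _ => [|i _ x _ <-]; rewrite ?lie0r ?lieDr. Qed.
Lemma lie_derivr x y z : lie x (lie y z) = lie (lie x y) z + lie y (lie x z).
Proof.
have /eqP := lie_jacobi x y z.
rewrite (lieC z (lie x y)) (lieC z x) lieNr.
rewrite subr_eq0 => /eqP <-; by rewrite addrNK.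
Qed.
Lemma lie_derivl x y z : lie (lie x y) z = lie (lie x z) y + lie x (lie y z).
Proof. by rewrite lie_derivr (lieC (lie x z) y) addrC -addrA subrr addr0. Qed.

Definition submod (P : L -> Prop) :=
  P 0 /\ forall c x y, P x -> P y -> P (c *: x + y).

Lemma submodD P x y : submod P -> P x -> P y -> P (x + y).
Proof. by case=> _ h px py; rewrite -[x]scale1r; apply: h. Qed.
Lemma submodZ P c x : submod P -> P x -> P (c *: x).
Proof. by case=> h0 h px; rewrite -[_ *: _]addr0; apply: h. Qed.
Lemma submodN P x : submod P -> P x -> P (- x).
Proof. by move=> h px; rewrite -scaleN1r; apply: submodZ. Qed.
Lemma submod_sum P (I : Type) (r : seq I) (Q : pred I) (G : I -> L) :
  submod P -> (forall i, Q i -> P (G i)) -> P (\sum_(i <- r | Q i) G i).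
Proof.
move=> h hG; elim/big_rec: _ => [|i x qi px]; first by case: h.
by apply: submodD => //; apply: hG.
Qed.

(** The span is the intersection of all submodules containing [S]: its induction principle is then
    the definition itself, and finite combinations appear only where they are wanted. *)
Definition lspan (S : L -> Prop) x := forall P, submod P -> (forall y, S y -> P y) -> P x.

Lemma lspan_submod S : submod (lspan S).
Proof.
split=> [P [] //|c x y hx hy P hP hS]; case: (hP) => _; apply; [exact: hx|exact: hy].
Qed.
Lemma lspan_in (S : L -> Prop) x : S x -> lspan S x.
Proof. by move=> sx P _; apply. Qed.
Lemma lspan0 (S : L -> Prop) : lspan S 0.
Proof. by case: (lspan_submod S). Qed.
Lemma lspanD (S : L -> Prop) x y : lspan S x -> lspan S y -> lspan S (x + y).
Proof. exact: submodD (lspan_submod S). Qed.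
Lemma lspanZ (S : L -> Prop) c x : lspan S x -> lspan S (c *: x).
Proof. exact: submodZ (lspan_submod S). Qed.
Lemma lspanN (S : L -> Prop) x : lspan S x -> lspan S (- x).
Proof. exact: submodN (lspan_submod S). Qed.
Lemma lspan_sum (S : L -> Prop) (I : Type) (r : seq I) (Q : pred I) (G : I -> L) :
  (forall i, Q i -> lspan S (G i)) -> lspan S (\sum_(i <- r | Q i) G i).
Proof. exact: submod_sum (lspan_submod S). Qed.
Lemma lspan_sub (S : L -> Prop) (P : L -> Prop) x :
  submod P -> (forall y, S y -> P y) -> lspan S x -> P x.
Proof. by move=> hP hS; apply. Qed.
Lemma submod_lie y (P : L -> Prop) : submod P -> submod (fun x => P (lie y x)).
Proof.
case=> P0 P1; split=> [|c u v hu hv]; first by rewrite lie0r.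
by rewrite lieDr lieZr; apply: P1.
Qed.

End Lie.

Section SubLie.
Variables (K : fieldType) (L : lieAlgType K).

Record lie_subalg := LieSubalg {
  subalg_pred :> L -> Prop;
  subalg_submod : submod subalg_pred;
  subalg_lie : forall x y, subalg_pred x -> subalg_pred y -> subalg_pred (lie x y) }.

Variable S : lie_subalg.

(** [km_universal] speaks of types with a Lie algebra structure, so a subalgebra given by a
    predicate has to become such a type. Boolean membership through [asbool] gives access to the
    subtype machinery. *)
Definition subalg_mem : pred L := fun x => `[< S x >].

Fact subalg_mem_closed : subsemimod_closed subalg_mem.
Proof.
split; first split.
- by apply/asboolP; case: (subalg_submod S).
- by move=> x y /asboolP hx /asboolP hy; apply/asboolP; exact: (submodD (subalg_submod S) hx hy).
- by move=> c x /asboolP hx; apply/asboolP; exact: (submodZ c (subalg_submod S) hx).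
Qed.

Record subalg_type := SubalgType { subalg_val : L; _ : subalg_mem subalg_val }.

HB.instance Definition _ := [isSub for subalg_val].
HB.instance Definition _ := [Choice of subalg_type by <:].
HB.instance Definition _ :=
  GRing.SubChoice_isSubLmodule.Build K L subalg_mem subalg_type subalg_mem_closed.

Definition subalg_bracket (x y : subalg_type) : subalg_type :=
  SubalgType (asboolT (subalg_lie (asboolW (valP x)) (asboolW (valP y)))).

Lemma subalg_valP c (u v : subalg_type) :
  subalg_val (c *: u + v) = c *: subalg_val u + subalg_val v.
Proof. exact: (linearP (\val : subalg_type -> L)). Qed.
Lemma subalg_val0 : subalg_val 0 = 0.
Proof. exact: (linear0 (\val : subalg_type -> L)). Qed.
Lemma subalg_valD (u v : subalg_type) :
  subalg_val (u + v) = subalg_val u + subalg_val v.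
Proof. exact: (linearD (\val : subalg_type -> L)). Qed.
Lemma subalg_valM (u v : subalg_type) :
  subalg_val (subalg_bracket u v) = lie (subalg_val u) (subalg_val v).
Proof. by []. Qed.
Lemma subalg_val_inj : injective subalg_val.
Proof. exact: val_inj. Qed.
Fact subalg_linear_l y : linear (subalg_bracket^~ y).
Proof.
by move=> c u v; apply: subalg_val_inj; rewrite !(subalg_valM, subalg_valP) lie_linear_l.
Qed.
Fact subalg_linear_r x : linear (subalg_bracket x).
Proof.
by move=> c u v; apply: subalg_val_inj; rewrite !(subalg_valM, subalg_valP) lie_linear_r.
Qed.
Fact subalg_alternating x : subalg_bracket x x = 0.
Proof.
by apply: subalg_val_inj; rewrite subalg_valM lie_alternating subalg_val0.
Qed.
Fact subalg_jacobi x y z :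
  subalg_bracket x (subalg_bracket y z) + subalg_bracket y (subalg_bracket z x) +
  subalg_bracket z (subalg_bracket x y) = 0.
Proof.
by apply: subalg_val_inj; rewrite !(subalg_valM, subalg_valD) subalg_val0 lie_jacobi.
Qed.

HB.instance Definition _ := Lmodule_isLie.Build K subalg_type
  subalg_linear_l subalg_linear_r subalg_alternating subalg_jacobi.

End SubLie.

(** * Generation and triangular decomposition *)

Section KacMoody.
Variables (K : fieldType) (n : nat) (A : 'M[int]_n) (h : realization K A).
Variables (L : lieAlgType K).

Section Swap.
Variable M : kac_moody h L.

Fact swap_inj : injective (fun t => - cartan M t).
Proof. by move=> s t /oppr_inj /(@cartan_inj _ _ _ _ _ M). Qed.

Lemma km_relations_swap (L' : lieAlgType K) (iota : h -> L') (e f : 'I_n -> L') :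
  km_relations iota e f -> km_relations (fun t => - iota t) f e.
Proof.
case=> lin hh ef he hf se sf; split=> //.
- by move=> c u v; rewrite lin opprD scalerN.
- by move=> x y; rewrite lieNl lieNr hh !oppr0.
- move=> i j; rewrite lieC ef eq_sym.
  by case: eqP => [->//|_]; rewrite oppr0.
- by move=> x i; rewrite lieNl hf scaleNr opprK.
- by move=> x i; rewrite lieNl he scaleNr.
Qed.

Fact swap_universal (L' : lieAlgType K) (iota : h -> L') (e f : 'I_n -> L') :
  km_relations iota e f ->
  exists2 phi : L -> L',
    [/\ lie_morphism phi,
        forall x, phi (- cartan M x) = iota x,
        forall i, phi (chev_f M i) = e i
      & forall i, phi (chev_e M i) = f i]
  & forall psi : L -> L',
    [/\ lie_morphism psi,
        forall x, psi (- cartan M x) = iota x,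
        forall i, psi (chev_f M i) = e i
      & forall i, psi (chev_e M i) = f i] -> psi =1 phi.
Proof.
move=> /km_relations_swap /(km_universal M) [phi [[lphi mphi] pi pe pf] uphi].
have oppE (psi : L -> L') : linear psi -> forall x, psi (- x) = - psi x.
  move=> lp x; pose g : {linear L -> L'} := HB.pack psi (GRing.isLinear.Build _ _ _ _ psi lp).
  exact: (linearN g).
exists phi; first by split=> // x; rewrite oppE // pi opprK.
move=> psi [[lpsi mpsi] si se sf]; apply: uphi; split=> // x.
by rewrite -[cartan M x]opprK oppE // si.
Qed.

(* The Chevalley involution, read as a second Kac-Moody structure on the same
   algebra, exchanges positive and negative roots. *)
Definition km_swap : kac_moody h L :=
  KacMoody swap_inj (km_relations_swap (km_rel M)) swap_universal.

End Swap.

Variable M : kac_moody h L.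

Notation iota := (cartan M).
Notation e := (chev_e M).
Notation f := (chev_f M).

Lemma cartan_linear : linear iota.
Proof. exact: (km_cartan_linear (km_rel M)). Qed.

HB.instance Definition _ := GRing.isLinear.Build K h L *:%R iota cartan_linear.

Lemma cartanC s t : lie (iota s) (iota t) = 0.
Proof. exact: (km_hh (km_rel M)). Qed.
Lemma lie_ef i j : lie (e i) (f j) = if i == j then iota (simple_coroot h i) else 0.
Proof. exact: (km_ef (km_rel M)). Qed.
Lemma cartan_e t i : lie (iota t) (e i) = (simple_root h i t : K) *: e i.
Proof. exact: (km_he (km_rel M)). Qed.
Lemma cartan_f t i : lie (iota t) (f i) = - (simple_root h i t : K) *: f i.
Proof. exact: (km_hf (km_rel M)). Qed.

(** The universal property maps [L] into [S]. Followed by the inclusion, this map fixes the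
    generators, hence is the identity. *)
Lemma km_subalg_ind (S : lie_subalg L) :
  (forall t, S (iota t)) -> (forall i, S (e i)) -> (forall i, S (f i)) ->
  forall x, S x.
Proof.
move=> Si Se Sf.
pose i' t : subalg_type S := SubalgType (asboolT (Si t)).
pose e' i : subalg_type S := SubalgType (asboolT (Se i)).
pose f' i : subalg_type S := SubalgType (asboolT (Sf i)).
have valL (u v : subalg_type S) : subalg_val (lie u v) = lie (subalg_val u) (subalg_val v) by [].
have valZ c (u : subalg_type S) : subalg_val (c *: u) = c *: subalg_val u.
  by rewrite -[c *: u]addr0 subalg_valP subalg_val0 addr0.
have valI (u v : subalg_type S) k : subalg_val (iter k (lie u) v) = iter k (lie (subalg_val u)) (subalg_val v).
  by elim: k => //= k IH; rewrite -IH.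
have rel' : km_relations i' e' f'.
  have [r1 r2 r3 r4 r5 r6 r7] := km_rel M.
  split.
  - by move=> c u v; apply: subalg_val_inj; rewrite subalg_valP /= r1.
  - by move=> x y; apply: subalg_val_inj; rewrite valL subalg_val0 /= r2.
  - move=> i j; apply: subalg_val_inj; rewrite valL /= r3.
    by case: eqP => //; rewrite subalg_val0.
  - by move=> x i; apply: subalg_val_inj; rewrite valL valZ /= r4.
  - by move=> x i; apply: subalg_val_inj; rewrite valL valZ /= r5.
  - by move=> i j ij; apply: subalg_val_inj; rewrite valI subalg_val0 /= r6.
  - by move=> i j ij; apply: subalg_val_inj; rewrite valI subalg_val0 /= r7.
have [phi [[pl pm] pi pe pf] _] := km_universal M rel'.
(* [phi0] only serves as a middle term: the identity and the composite through [S] both agree with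
   it by uniqueness. *)
have [phi0 _ u0] := km_universal M (km_rel M).
move=> x; have -> : x = subalg_val (phi x).
  rewrite (u0 (fun x => subalg_val (phi x))); last first.
    split; first split.
    - by move=> c u v; rewrite pl subalg_valP.
    - by move=> u v; rewrite pm.
    - by move=> t; rewrite pi.
    - by move=> i; rewrite pe.
    - by move=> i; rewrite pf.
  by rewrite -(u0 id).
by apply: asboolW; apply: (valP (phi x)).
Qed.

(** The elements whose adjoint action preserves [P] form a subalgebra containing the generators,
    hence are everything. So [P] is itself a subalgebra, and it contains the generators. *)
Lemma km_stable_ind (P : L -> Prop) : submod P ->
  (forall t, P (iota t)) -> (forall i, P (e i)) -> (forall i, P (f i)) ->
  (forall t x, P x -> P (lie (iota t) x)) ->
  (forall i x, P x -> P (lie (e i) x)) ->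
  (forall i x, P x -> P (lie (f i) x)) -> forall x, P x.
Proof.
move=> Ps Pi Pe Pf Si Se Sf.
have Nsub : submod (fun x => forall y, P y -> P (lie x y)).
  split=> [y py|c u v hu hv y py]; first by rewrite lie0l; case: Ps.
  by rewrite lieDl lieZl; case: (Ps) => _; apply; [exact: hu|exact: hv].
have Nlie u v : (forall y, P y -> P (lie u y)) -> (forall y, P y -> P (lie v y)) ->
    forall y, P y -> P (lie (lie u v) y).
  move=> hu hv y py.
  have -> : lie (lie u v) y = lie u (lie v y) - lie v (lie u y).
    by rewrite lie_derivr addrK.
  apply: submodD => //; first by apply/hu/hv.
  by apply: submodN => //; apply/hv/hu.
have all := km_subalg_ind (S := LieSubalg Nsub Nlie) Si Se Sf.
exact: (km_subalg_ind (S := LieSubalg Ps (fun x y _ py => all x y py)) Pi Pe Pf).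
Qed.

(** Right-normed brackets. Singletons are matched separately because bracketing with the value 0 of
    the empty word would annihilate every word. *)
Fixpoint word (g : 'I_n -> L) (s : seq 'I_n) : L :=
  match s with
  | [::] => 0
  | [:: i] => g i
  | i :: s' => lie (g i) (word g s')
  end.

Lemma word_cons g i s : s != [::] -> word g (i :: s) = lie (g i) (word g s).
Proof. by case: s. Qed.

End KacMoody.

(** * Weight spaces and their independence *)

Section Weights.
Variables (K : fieldType) (a : vectType K) (L : lieAlgType K) (iota : a -> L).
Implicit Types (g d : 'Hom(a, K^o)) (x y : L).

Lemma weight_submod g : submod (weight_space iota g).
Proof.
split=> [t|c x y hx hy t]; first by rewrite lie0r scaler0.
by rewrite lieDr lieZr hx hy scalerDr !scalerA mulrC.
Qed.

Lemma weightZ g c x : weight_space iota g x -> weight_space iota g (c *: x).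
Proof. exact: submodZ (weight_submod g). Qed.

Lemma weight_lie g d x y :
  weight_space iota g x -> weight_space iota d y ->
  weight_space iota (g + d) (lie x y).
Proof.
move=> hx hy t; rewrite lie_derivr hx hy lieZl lieZr -scalerDl.
by rewrite add_lfunE.
Qed.

(** If some entry has weight [d != g], choose [t] with [d t != g t] and apply ad t - d(t). This
    removes the entries of weight [d] and multiplies the part of weight [g] by a nonzero scalar, so
    the number of entries of weight other than [g] drops. *)
Lemma weight_sum0 (s : seq ('Hom(a, K^o) * L)) :
  (forall u, u \in s -> weight_space iota u.1 u.2) ->
  \sum_(u <- s) u.2 = 0 -> forall g, \sum_(u <- s | u.1 == g) u.2 = 0.
Proof.
move=> hs s0 g; move: {2}(size _) (leqnn (size [seq u <- s | u.1 != g])) hs s0 => N.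
elim: N s => [|N IH] s hN hs s0.
  suff /all_filterP fs : all [pred u | u.1 == g] s by rewrite -big_filter fs.
  apply/allP => u us /=; apply: contraLR hN => ug.
  by rewrite leqn0 size_eq0 -has_filter; apply/hasP; exists u.
have [/allP fs|] := boolP (all [pred u | u.1 == g] s).
  rewrite big_seq_cond (eq_bigl (fun u => u \in s)) -?big_seq // => u.
  by case us: (u \in s) => //=; apply: fs.
case/allPn=> -[d v] us /= dg.
have [t dt] : exists t, d t != g t.
  apply: contrapT => hn; case/negP: dg; apply/eqP/lfunP => t.
  by apply: contrapT => ht; apply: hn; exists t; apply/eqP.
pose c (u : 'Hom(a, K^o) * L) : K := (u.1 t : K) - (d t : K).
pose s' := [seq (u.1, c u *: u.2) | u <- s & u.1 != d].
have sumE (P : pred 'Hom(a, K^o)) :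
    \sum_(u <- s' | P u.1) u.2 =
    \sum_(u <- s | P u.1) lie (iota t) u.2 - (d t : K) *: \sum_(u <- s | P u.1) u.2.
  rewrite /s' big_map big_filter_cond scaler_sumr -sumrB.
  rewrite [RHS](bigID (fun u => u.1 == d)) /=.
  rewrite [X in _ = X + _]big_seq_cond [X in _ = X + _]big1 ?add0r; last first.
    move=> u /and3P [us' _ /eqP ud]; rewrite (hs _ us') ud; exact: subrr.
  rewrite big_seq_cond [RHS]big_seq_cond; apply: eq_big => u.
    by rewrite [P _ && _]andbC.
  by case/and3P => us' _ _; rewrite (hs _ us') /c scalerBl.
have /IH : (size [seq u <- s' | u.1 != g] <= N)%N.
  rewrite -ltnS; apply: leq_trans hN.
  have -> : size [seq u <- s' | u.1 != g] = count (fun u => u.1 != d) [seq u <- s | u.1 != g].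
    by rewrite size_filter count_map !count_filter; apply: eq_count => u /=; rewrite andbC.
  rewrite -[leqRHS](count_predC (fun u => u.1 != d)).
  rewrite -addn1 leq_add2l -has_count.
  by apply/hasP; exists (d, v); rewrite ?mem_filter /= ?dg ?negbK.
have hs' u : u \in s' -> weight_space iota u.1 u.2.
  move=> /mapP [w]; rewrite mem_filter => /andP [_ /hs hw] -> /=.
  exact: (submodZ (c w) (weight_submod _) hw).
have s'0 : \sum_(u <- s') u.2 = 0.
  have -> : \sum_(u <- s') u.2 = \sum_(u <- s' | predT u.1) u.2 by [].
  by rewrite sumE /= s0 scaler0 subr0 -lie_sumr s0 lie0r.
move=> /(_ hs' s'0).
move/eqP; rewrite (sumE (fun d' => d' == g)).
have -> : \sum_(u <- s | u.1 == g) lie (iota t) u.2 = (g t : K) *: \sum_(u <- s | u.1 == g) u.2.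
  rewrite scaler_sumr big_seq_cond [RHS]big_seq_cond; apply: eq_bigr => u /andP [us' /eqP ug].
  by rewrite (hs _ us') ug.
rewrite -scalerBl scaler_eq0 subr_eq0 => /orP [|/eqP //].
by rewrite eq_sym (negbTE dt).
Qed.

Lemma weight_proj (s : seq ('Hom(a, K^o) * L)) g x :
  (forall u, u \in s -> weight_space iota u.1 u.2) -> weight_space iota g x ->
  x = \sum_(u <- s) u.2 -> x = \sum_(u <- s | u.1 == g) u.2.
Proof.
move=> hs hx xE.
have h' u : u \in (g, - x) :: s -> weight_space iota u.1 u.2.
  by rewrite inE => /orP [/eqP -> /=|/hs //]; exact: (submodN (weight_submod _) hx).
have := weight_sum0 h' _ g; rewrite !big_cons /= eqxx -xE addNr => /(_ erefl).
by move/eqP; rewrite addrC subr_eq0 => /eqP.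
Qed.

End Weights.

Lemma sum_keyed0 (T : eqType) (V : zmodType) (s : seq (T * V)) :
  (forall g, \sum_(u <- s | u.1 == g) u.2 = 0) -> \sum_(u <- s) u.2 = 0.
Proof.
move: {2}(size s) (leqnn (size s)) => N.
elim: N s => [|N IH] s; first by case: s => // _ _; rewrite big_nil.
case: s => [|u s]; first by rewrite big_nil.
rewrite /= ltnS => hN hs.
rewrite (bigID (fun v => v.1 == u.1)) /= hs add0r -big_filter.
apply: IH; first by rewrite /= eqxx /= size_filter (leq_trans (count_size _ _)).
move=> g; rewrite big_filter_cond.
have [->|gu] := eqVneq g u.1.
  by rewrite big_pred0 // => v; case: eqP.
rewrite -[RHS](hs g); apply: eq_bigl => v; rewrite andbC.
by have [->|//] := eqVneq v.1 g; rewrite gu.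
Qed.

(** * Representations of sl2 *)

Section Sl2.
Variables (K : numFieldType) (L : lieAlgType K) (e f c : L).
Hypotheses (ef : lie e f = c) (ce : lie c e = 2 *: e) (cf : lie c f = - 2 *: f).

Lemma sl2_pow_e (x : L) (n : K) k : lie c x = n *: x ->
  lie c (iter k (lie e) x) = (n + k%:R *+ 2) *: iter k (lie e) x.
Proof.
move=> cx; elim: k => [|k IH] /=; first by rewrite mul0rn addr0.
rewrite lie_derivr ce IH lieZl lieZr -scalerDl; congr (_ *: _).
by rewrite -[k.+1]addn1 natrD; ring.
Qed.

Lemma sl2_pow_f (x : L) (n : K) k : lie c x = n *: x ->
  lie c (iter k (lie f) x) = (n - k%:R *+ 2) *: iter k (lie f) x.
Proof.
move=> cx; elim: k => [|k IH] /=; first by rewrite mul0rn subr0.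
rewrite lie_derivr cf IH lieZl lieZr -scalerDl; congr (_ *: _).
by rewrite -[k.+1]addn1 natrD; ring.
Qed.

Lemma sl2_highest_ef (v : L) (n : K) k : lie c v = n *: v -> lie e v = 0 ->
  lie e (iter k.+1 (lie f) v) = (k.+1%:R * (n - k%:R)) *: iter k (lie f) v.
Proof.
move=> cv ev; elim: k => [|k IH].
  by rewrite /= lie_derivr ef ev lie0r addr0 cv subr0 mul1r.
rewrite iterS lie_derivr ef IH lieZr (sl2_pow_f _ cv) -scalerDl; congr (_ *: _).
by rewrite -[k.+2]addn2 -[k.+1]addn1 !natrD; ring.
Qed.

(** If f^k v is the last nonzero power, applying e to f^(k+1) v = 0 gives (k+1)(n - k) = 0, which
    makes the eigenvalue a natural number. *)
Lemma sl2_highest (v : L) (n : K) : lie c v = n *: v -> lie e v = 0 -> v != 0 ->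
  (exists N, iter N (lie f) v = 0) ->
  exists k : nat, [/\ n = k%:R, forall j, (j <= k)%N -> iter j (lie f) v != 0
    & iter k.+1 (lie f) v = 0].
Proof.
move=> cv ev v0 nil.
have nilb : exists N, iter N (lie f) v == 0 by case: nil => N hN; exists N; rewrite hN.
case: (ex_minnP nilb) => -[|k] /eqP hk mink.
  by move: hk v0 => /= ->; rewrite eqxx.
have hj j : (j <= k)%N -> iter j (lie f) v != 0.
  by move=> jk; apply/negP => /mink; rewrite ltnNge jk.
exists k; split=> //.
have := sl2_highest_ef k cv ev; rewrite hk lie0r => /esym/eqP.
rewrite scaler_eq0 (negbTE (hj _ (leqnn k))) orbF mulf_eq0 pnatr_eq0 /= subr_eq0.
by move/eqP.
Qed.

Lemma sl2_string (x : L) (n : K) : lie c x = n *: x -> x != 0 ->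
  (exists N, iter N (lie e) x = 0) ->
  (forall k, exists N, iter N (lie f) (iter k (lie e) x) = 0) ->
  exists k N : nat, n + k%:R *+ 2 = N%:R /\
    forall j, (j <= N)%N -> iter j (lie f) (iter k (lie e) x) != 0.
Proof.
move=> cx x0 nil nilf.
have nilb : exists N, iter N (lie e) x == 0 by case: nil => N hN; exists N; rewrite hN.
case: (ex_minnP nilb) => -[|k] /eqP hk mink.
  by move: hk x0 => /= ->; rewrite eqxx.
have y0 : iter k (lie e) x != 0 by apply/negP => /mink; rewrite ltnn.
have [N [nN hN _]] := sl2_highest (sl2_pow_e k cx) hk y0 (nilf k).
by exists k, N.
Qed.

End Sl2.

Section Reflection.
Variables (K : numFieldType) (a : vectType K) (L : lieAlgType K) (iota : a -> L).
Variables (al : 'Hom(a, K^o)) (e f : L) (d : a).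
Hypotheses (we : weight_space iota al e) (wf : weight_space iota (- al) f).
Hypotheses (ef : lie e f = iota d) (ald : al d = 2 :> K).

Let ce : lie (iota d) e = 2 *: e. Proof. by rewrite we ald. Qed.
Let cf : lie (iota d) f = - 2 *: f. Proof. by rewrite wf opp_lfunE ald. Qed.

Lemma weight_iter_lie (g be : 'Hom(a, K^o)) (u x : L) k :
  weight_space iota g u -> weight_space iota be x ->
  weight_space iota (be + g *+ k) (iter k (lie u) x).
Proof.
move=> hu hx; elim: k => [|k IH] /=; first by rewrite mulr0n addr0.
by have := weight_lie hu IH; rewrite addrCA -mulrS.
Qed.

Lemma weight_reflect (be : 'Hom(a, K^o)) (x : L) :
  weight_space iota be x -> x != 0 ->
  (forall k, exists N, iter N (lie f) (iter k (lie e) x) = 0) ->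
  (forall k, exists N, iter N (lie e) (iter k (lie f) x) = 0) ->
  exists z : int, be d = z%:~R :> K /\
    exists2 y, weight_space iota (be - al *~ z) y & y != 0.
Proof.
move=> wx x0 nilf nile.
have fe : lie f e = - iota d by rewrite lieC ef.
have ce' : lie (- iota d) e = - 2 *: e by rewrite lieNl ce scaleNr.
have cf' : lie (- iota d) f = 2 *: f by rewrite lieNl cf scaleNr opprK.
have [k [N [nN hN]]] := sl2_string ef ce cf (wx d) x0 (nile 0%N) nilf.
have [k' [N' [nN' hN']]] : exists k' N' : nat, - (be d : K) + k'%:R *+ 2 = N'%:R /\
    forall j, (j <= N')%N -> iter j (lie e) (iter k' (lie f) x) != 0.
  by apply: (sl2_string fe cf' ce' _ x0 (nilf 0%N) nile); rewrite lieNl (wx d) scaleNr.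
have bez : be d = (N%:Z - (k + k)%:Z)%:~R :> K.
  by rewrite intrB -!pmulrn -nN natrD; ring.
exists (N%:Z - (k + k)%:Z); split=> //.
have eqz : (N%:Z - (k + k)%:Z) = ((k' + k')%:Z - N'%:Z).
  by apply: (@intr_inj K); rewrite -bez intrB -!pmulrn -nN' natrD; ring.
(* If [k <= N], lowering the top vector [N - k] times reaches the reflected weight. Otherwise the
   bottom vector is raised [N' - k'] times; having both ends of the string at hand spares a proof
   that [k <= N]. *)
have [kN|Nk] := leqP k N.
  exists (iter (N - k) (lie f) (iter k (lie e) x)); last by apply: hN; apply: leq_subr.
  have := weight_iter_lie (N - k) wf (weight_iter_lie k we wx).
  suff -> : be + al *+ k + (- al) *+ (N - k) = be - al *~ (N%:Z - (k + k)%:Z) by [].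
  rewrite mulNrn -addrA; congr (_ + _).
  rewrite -[al *+ k]/(al *~ k%:Z) -[al *+ (N - k)]/(al *~ (N - k)%:Z) -mulrzBr.
  by rewrite -mulrNz; congr (_ *~ _); lia.
exists (iter (N' - k') (lie e) (iter k' (lie f) x)); last by apply: hN'; apply: leq_subr.
have := weight_iter_lie (N' - k') we (weight_iter_lie k' wf wx).
suff -> : be + (- al) *+ k' + al *+ (N' - k') = be - al *~ (N%:Z - (k + k)%:Z) by [].
rewrite mulNrn -addrA; congr (_ + _).
rewrite -[al *+ k']/(al *~ k'%:Z) -[al *+ (N' - k')]/(al *~ (N' - k')%:Z) addrC -mulrzBr.
by rewrite -mulrNz; congr (_ *~ _); lia.
Qed.

End Reflection.

(** * The root lattice in integer coordinates, and heights *)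

Section RootLattice.
Variables (K : numFieldType) (n : nat) (A : 'M[int]_n) (h : realization K A).
Local Notation Q := 'rV[int]_n.

Definition rt (z : Q) : 'Hom(h, K^o) := \sum_i simple_root h i *~ z 0 i.

Fact rt_is_zmod_morphism : zmod_morphism rt.
Proof.
by move=> y z; rewrite /rt -sumrB; apply: eq_bigr => i _; rewrite !mxE mulrzBr.
Qed.
HB.instance Definition _ := GRing.isZmodMorphism.Build _ _ rt rt_is_zmod_morphism.

Lemma rtE z t : rt z t = \sum_i (z 0 i)%:~R * (simple_root h i t : K) :> K.
Proof.
rewrite /rt sum_lfunE; apply: eq_bigr => i _.
rewrite -[simple_root h i *~ _]scaler_int scale_lfunE; congr (_ * _).
Qed.

Definition dl (i : 'I_n) : Q := delta_mx 0 i.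

Lemma rt_dl i : rt (dl i) = simple_root h i.
Proof.
rewrite /rt (bigD1 i) //= big1 => [|k ki]; last by rewrite mxE eqxx (negbTE ki) mulr0z.
by rewrite mxE !eqxx mulr1z addr0.
Qed.

Lemma simple_roots_indep (x : 'I_n -> K) :
  (forall t, \sum_i x i * (simple_root h i t : K) = 0) -> forall i, x i = 0.
Proof.
move=> x0; have fr := simple_root_free h.
have sz : size [seq simple_root h i | i <- enum 'I_n] == n by rewrite size_map size_enum_ord.
have := @freeP _ _ _ (Tuple sz) fr x; apply.
apply/lfunP => t; rewrite sum_lfunE [RHS]zero_lfunE -[RHS](x0 t).
apply: eq_bigr => i _; rewrite scale_lfunE /=; congr (_ *: _).
by rewrite (nth_map i) ?size_enum_ord // nth_ord_enum.
Qed.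

Lemma coroots_indep (x : 'I_n -> K) :
  \sum_i x i *: simple_coroot h i = 0 -> forall i, x i = 0.
Proof.
move=> x0; have fr := simple_coroot_free h.
have sz : size [seq simple_coroot h i | i <- enum 'I_n] == n by rewrite size_map size_enum_ord.
have := @freeP _ _ _ (Tuple sz) fr x; apply.
rewrite -[RHS]x0; apply: eq_bigr => i _; congr (_ *: _).
by rewrite /= (nth_map i) ?size_enum_ord // nth_ord_enum.
Qed.

Lemma rt_inj : injective rt.
Proof.
move=> y z yz; apply/rowP => i.
have H := simple_roots_indep (x := fun i => ((y - z) 0 i)%:~R).
have /eqP : ((y - z) 0 i)%:~R = 0 :> K.
  by apply: H => t; rewrite -rtE raddfB /= yz subrr zero_lfunE.
by rewrite intr_eq0 !mxE subr_eq0 => /eqP.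
Qed.

Lemma rt_eq0 z : (rt z == 0) = (z == 0).
Proof. by rewrite -(raddf0 rt) (inj_eq rt_inj). Qed.

Definition content (s : seq 'I_n) : Q := \sum_(i <- s) dl i.

Lemma contentE s i : content s 0 i = (count_mem i s)%:Z.
Proof.
rewrite /content; elim: s => [|k s IH]; first by rewrite big_nil mxE.
by rewrite big_cons !mxE IH /= PoszD [i == k]eq_sym; case: (k == i).
Qed.

Lemma content_cons i s : content (i :: s) = dl i + content s.
Proof. by rewrite /content big_cons. Qed.

Definition zge0 (z : Q) := [forall i, 0 <= z 0 i].
Lemma zge0P (z : Q) : reflect (forall i, 0 <= z 0 i) (zge0 z).
Proof. exact: forallP. Qed.

Lemma content_ge0 s : zge0 (content s).
Proof. by apply/zge0P => i; rewrite contentE lez_nat. Qed.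

Lemma content_eq0 s : (content s == 0) = (s == [::]).
Proof.
case: s => [|i s]; first by rewrite /content big_nil eqxx.
by apply/negbTE/eqP => /matrixP /(_ 0 i); rewrite contentE mxE /= eqxx.
Qed.

Definition ht (z : Q) : int := \sum_i z 0 i.
Lemma htD y z : ht (y + z) = ht y + ht z.
Proof. by rewrite /ht -big_split; apply: eq_bigr => i _; rewrite mxE. Qed.
Lemma htN y : ht (- y) = - ht y.
Proof. by rewrite /ht -sumrN; apply: eq_bigr => i _; rewrite mxE. Qed.
Lemma ht_dl i : ht (dl i) = 1.
Proof.
rewrite /ht (bigD1 i) //= big1 => [|k ki]; last by rewrite mxE eqxx (negbTE ki).
by rewrite mxE !eqxx.
Qed.
Lemma ht_content s : ht (content s) = (size s)%:Z.
Proof.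
elim: s => [|i s IH]; first by rewrite /content big_nil /ht big1 // => i; rewrite mxE.
by rewrite content_cons htD ht_dl IH.
Qed.
Lemma ht_ge0 z : zge0 z -> 0 <= ht z.
Proof. by move/zge0P => hz; apply: sumr_ge0. Qed.
Lemma ht_eq0 z : zge0 z -> (ht z == 0) = (z == 0).
Proof.
move/zge0P => hz; rewrite /ht psumr_eq0 //; apply/allP/eqP => [h0|-> i _]; last by rewrite mxE.
by apply/rowP => i; rewrite mxE; apply/eqP/(h0 i); rewrite mem_index_enum.
Qed.
Lemma zge0_anti z : zge0 z -> zge0 (- z) -> z = 0.
Proof.
move=> /zge0P z0 /zge0P z1; apply/rowP => i; rewrite mxE.
by apply/eqP; rewrite eq_le z0 andbT; have := z1 i; rewrite mxE oppr_ge0.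
Qed.

Variables (L : lieAlgType K) (M : kac_moody h L).
Notation iota := (cartan M).
Notation e := (chev_e M).
Notation f := (chev_f M).
Notation weight := (weight_space iota).

Lemma weight_e i : weight (rt (dl i)) (e i).
Proof. by move=> t; rewrite rt_dl cartan_e. Qed.
Lemma weight_f i : weight (rt (- dl i)) (f i).
Proof. by move=> t; rewrite raddfN /= rt_dl opp_lfunE cartan_f. Qed.
Lemma weight_cartan t : weight (rt 0) (iota t).
Proof. by move=> s; rewrite raddf0 zero_lfunE scale0r cartanC. Qed.

Lemma weight_word_e s : weight (rt (content s)) (word e s).
Proof.
elim: s => [t|i s IH]; first by rewrite lie0r scaler0.
have [->|s0] := eqVneq s [::]; first by rewrite /content big_seq1; apply: weight_e.
rewrite word_cons // content_cons raddfD; apply: weight_lie IH; exact: weight_e.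
Qed.
Lemma weight_word_f s : weight (rt (- content s)) (word f s).
Proof.
elim: s => [t|i s IH]; first by rewrite lie0r scaler0.
have [->|s0] := eqVneq s [::]; first by rewrite /content big_seq1; apply: weight_f.
rewrite word_cons // content_cons opprD raddfD; apply: weight_lie IH; exact: weight_f.
Qed.

Lemma lie_ef_coroot i j : exists c : K, lie (e i) (f j) = iota (c *: simple_coroot h i).
Proof.
rewrite lie_ef; case: eqP => _; first by exists 1; rewrite scale1r.
by exists 0; rewrite scale0r linear0.
Qed.

End RootLattice.

Section Triangular.
Variables (K : numFieldType) (n : nat) (A : 'M[int]_n) (h : realization K A).
Variables (L : lieAlgType K).

Definition triang (M : kac_moody h L) x :=
  [\/ exists t, x = cartan M t, exists s, x = word (chev_e M) s
    | exists s, x = word (chev_f M) s].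

Definition negpart (M : kac_moody h L) x :=
  (exists t, x = cartan M t) \/ exists s, x = word (chev_f M) s.

(** Positive words are kept out of the target: the induction brackets the result with [f j], and
    this must not lead out of the span. *)
Lemma negpart_e (M : kac_moody h L) i s :
  lspan (negpart M) (lie (chev_e M i) (word (chev_f M) s)).
Proof.
elim: s => [|j s IH]; first by rewrite lie0r; apply: lspan0.
have [->|s0] := eqVneq s [::].
  rewrite /=; have [c ->] := lie_ef_coroot M i j.
  by apply: lspan_in; left; exists (c *: simple_coroot h i).
rewrite word_cons // lie_derivr; apply: lspanD.
  have [c ->] := lie_ef_coroot M i j.
  by rewrite (weight_word_f M s); apply: lspanZ; apply: lspan_in; right; exists s.
apply: (lspan_sub (P := fun y => lspan (negpart M) (lie (chev_f M j) y))) IH; first exact/submod_lie/lspan_submod.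
move=> y; case=> [[t ->]|[s' ->]].
  by rewrite lieC cartan_f; apply: lspanN; apply: lspanZ; apply: lspan_in; right; exists [:: j].
have [->|s'0] := eqVneq s' [::]; first by rewrite lie0r; apply: lspan0.
by apply: lspan_in; right; exists (j :: s'); rewrite word_cons.
Qed.

Lemma triang_e (M : kac_moody h L) i x :
  lspan (triang M) x -> lspan (triang M) (lie (chev_e M i) x).
Proof.
apply: (lspan_sub (P := fun y => lspan (triang M) (lie (chev_e M i) y))).
  exact/submod_lie/lspan_submod.
move=> y; case=> [[t ->]|[s ->]|[s ->]].
- by rewrite lieC cartan_e; apply: lspanN; apply: lspanZ; apply: lspan_in; apply: Or32; exists [:: i].
- have [->|s0] := eqVneq s [::]; first by rewrite lie0r; apply: lspan0.
  by apply: lspan_in; apply: Or32; exists (i :: s); rewrite word_cons.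
- refine (lspan_sub (lspan_submod _) _ (negpart_e i s)).
  move=> z [hz|hz]; apply: lspan_in; first exact: Or31.
  exact: Or33.
Qed.

Lemma triang_swap (M : kac_moody h L) x : triang (km_swap M) x <-> triang M x.
Proof.
split; (case=> [[t ->]|[s ->]|[s ->]]; [apply: Or31|apply: Or33|apply: Or32]).
- by exists (- t); rewrite linearN.
- by exists s.
- by exists s.
- by exists (- t); rewrite /= linearN opprK.
- by exists s.
- by exists s.
Qed.

Lemma lspan_triang_swap (M : kac_moody h L) x :
  lspan (triang (km_swap M)) x <-> lspan (triang M) x.
Proof.
by split=> hx P hP hS; apply: hx => // y /triang_swap; apply: hS.
Qed.

Variable M : kac_moody h L.

Lemma triang_span x : lspan (triang M) x.
Proof.
have sub := lspan_submod (triang M).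
apply: (km_stable_ind (M := M)) => //.
- by move=> t; apply: lspan_in; apply: Or31; exists t.
- by move=> i; apply: lspan_in; apply: Or32; exists [:: i].
- by move=> i; apply: lspan_in; apply: Or33; exists [:: i].
- move=> t y; apply: (lspan_sub (P := fun y => lspan (triang M) (lie (cartan M t) y))); first exact/submod_lie/lspan_submod.
  move=> z [[s ->]|[s ->]|[s ->]].
  + by rewrite cartanC; apply: lspan0.
  + by rewrite (weight_word_e M s); apply: lspanZ; apply: lspan_in; apply: Or32; exists s.
  + by rewrite (weight_word_f M s); apply: lspanZ; apply: lspan_in; apply: Or33; exists s.
- by move=> i y; apply: triang_e.
- move=> i y /lspan_triang_swap hy; apply/lspan_triang_swap.
  exact (triang_e (M := km_swap M) i hy).
Qed.

(* Words are allowed to be empty here; the empty word denotes 0. *)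
Lemma triang_decomp x : exists t (se sf : seq (K * seq 'I_n)),
  x = cartan M t + \sum_(u <- se) u.1 *: word (chev_e M) u.2
                 + \sum_(u <- sf) u.1 *: word (chev_f M) u.2.
Proof.
apply: (triang_span x (P := fun x => exists t (se sf : seq (K * seq 'I_n)),
  x = cartan M t + \sum_(u <- se) u.1 *: word (chev_e M) u.2
                 + \sum_(u <- sf) u.1 *: word (chev_f M) u.2)).
  split=> [|c u v [t [se [sf ->]]] [t' [se' [sf' ->]]]].
    by exists 0, [::], [::]; rewrite !big_nil linear0 !addr0.
  exists (c *: t + t'), ([seq (c * u.1, u.2) | u <- se] ++ se'),
     ([seq (c * u.1, u.2) | u <- sf] ++ sf').
  rewrite linearP !big_cat !big_map /= !scalerDr !scaler_sumr.
  rewrite addrACA [X in X + _ = _]addrACA.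
  by congr (_ + (_ + _) + (_ + _)); apply: eq_bigr => w _; rewrite scalerA.
move=> y; case=> [[t ->]|[s ->]|[s ->]].
- by exists t, [::], [::]; rewrite !big_nil !addr0.
- by exists 0, [:: (1, s)], [::]; rewrite big_seq1 big_nil linear0 add0r addr0 scale1r.
- by exists 0, [::], [:: (1, s)]; rewrite big_seq1 big_nil linear0 !add0r scale1r.
Qed.

Lemma weight_decomp x : exists s : seq ('rV[int]_n * L),
  x = \sum_(u <- s) u.2 /\
  forall u, u \in s -> weight_space (cartan M) (rt h u.1) u.2.
Proof.
have [t [se [sf ->]]] := triang_decomp x.
exists ((0, cartan M t) ::
  [seq (content u.2, u.1 *: word (chev_e M) u.2) | u <- se] ++
  [seq (- content u.2, u.1 *: word (chev_f M) u.2) | u <- sf]).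
rewrite big_cons big_cat !big_map addrA; split=> //= u.
rewrite inE mem_cat => /or3P [/eqP ->|/mapP [w _ ->]|/mapP [w _ ->]] /=.
- exact: weight_cartan.
- exact/weightZ/weight_word_e.
- exact/weightZ/weight_word_f.
Qed.

Lemma weight_triang (g : 'Hom(h, K^o)) x : weight_space (cartan M) g x ->
  exists t (se sf : seq (K * seq 'I_n)),
  x = (if g == 0 then cartan M t else 0)
      + \sum_(u <- se | rt h (content u.2) == g) u.1 *: word (chev_e M) u.2
      + \sum_(u <- sf | rt h (- content u.2) == g) u.1 *: word (chev_f M) u.2.
Proof.
move=> wx; have [t [se [sf xE]]] := triang_decomp x; exists t, se, sf.
pose s : seq ('Hom(h, K^o) * L) := (0, cartan M t) ::
  [seq (rt h (content u.2), u.1 *: word (chev_e M) u.2) | u <- se] ++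
  [seq (rt h (- content u.2), u.1 *: word (chev_f M) u.2) | u <- sf].
have hs u : u \in s -> weight_space (cartan M) u.1 u.2.
  rewrite inE mem_cat => /or3P [/eqP ->|/mapP [w _ ->]|/mapP [w _ ->]] /=.
  - by rewrite -(raddf0 (rt h)); exact: weight_cartan.
  - exact/weightZ/weight_word_e.
  - exact/weightZ/weight_word_f.
rewrite (weight_proj hs wx) /s ?big_cons ?big_cat ?big_map /= ?addrA //.
by rewrite eq_sym; case: (g == 0); rewrite ?add0r ?addrA.
Qed.

Lemma weight_mixed z x : weight_space (cartan M) (rt h z) x ->
  ~~ zge0 z -> ~~ zge0 (- z) -> x = 0.
Proof.
move=> wx z1 z2; have [t [se [sf ->]]] := weight_triang wx.
have z0 : z != 0 by apply: contraNneq z1 => ->; apply/zge0P => i; rewrite mxE.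
rewrite rt_eq0 (negbTE z0) add0r !big_pred0 ?addr0 // => u.
  by apply/negP => /eqP /rt_inj uz; move: z2; rewrite -uz opprK content_ge0.
by apply/negP => /eqP /rt_inj uz; move: z1; rewrite -uz content_ge0.
Qed.

Lemma weight_zero x : weight_space (cartan M) (rt h 0) x -> exists t, x = cartan M t.
Proof.
move=> wx; have [t [se [sf ->]]] := weight_triang wx; exists t.
rewrite rt_eq0 eqxx big1 ?big1 ?addr0 // => u /eqP /rt_inj /eqP; rewrite ?oppr_eq0.
  by rewrite content_eq0 => /eqP ->; rewrite scaler0.
by rewrite content_eq0 => /eqP ->; rewrite scaler0.
Qed.

Lemma weight_pos z x : weight_space (cartan M) (rt h z) x -> z != 0 -> zge0 z ->
  exists s : seq (K * seq 'I_n), x = \sum_(u <- s | content u.2 == z) u.1 *: word (chev_e M) u.2.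
Proof.
move=> wx z0 z1; have [t [se [sf ->]]] := weight_triang wx; exists se.
rewrite rt_eq0 (negbTE z0) add0r [X in _ + X]big_pred0 ?addr0 => [|u].
  by apply: eq_bigl => u; rewrite (inj_eq (@rt_inj _ _ _ h)).
apply/negP => /eqP /rt_inj uz; case/eqP: z0; apply: zge0_anti => //.
by rewrite -uz opprK content_ge0.
Qed.

End Triangular.

(** * Local nilpotency of the Chevalley generators *)

Section Nilpotency.
Variables (K : numFieldType) (L : lieAlgType K).

Lemma iter_lie0 (u : L) N : iter N (lie u) 0 = 0.
Proof. by elim: N => //= N ->; rewrite lie0r. Qed.

Lemma iter_lie_le (u x : L) N N' : (N <= N')%N -> iter N (lie u) x = 0 -> iter N' (lie u) x = 0.
Proof. by move=> /subnK <-; rewrite iterD => ->; rewrite iter_lie0. Qed.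

Lemma iter_lieP (u : L) N c x y :
  iter N (lie u) (c *: x + y) = c *: iter N (lie u) x + iter N (lie u) y.
Proof. by elim: N => //= N ->; rewrite lieDr lieZr. Qed.

Definition ad_nil (u x : L) := exists N, iter N (lie u) x = 0.

Lemma ad_nil_submod u : submod (ad_nil u).
Proof.
split=> [|c x y [N hN] [N' hN']]; first by exists 0%N.
exists (maxn N N'); rewrite iter_lieP.
rewrite (iter_lie_le (leq_maxl _ _) hN) (iter_lie_le (leq_maxr _ _) hN').
by rewrite scaler0 addr0.
Qed.

Lemma ad_nil_lie u x y : ad_nil u x -> ad_nil u y -> ad_nil u (lie x y).
Proof.
move=> [N hN] [N' hN']; exists (N + N')%N.
move: {2}(N + N')%N (erefl (N + N')%N) => k.
elim: k N N' x y hN hN' => [|k IH] N N' x y.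
  move=> hN _ /eqP; rewrite addn_eq0 => /andP [/eqP N0 _].
  by move: hN; rewrite N0 /= => ->; rewrite lie0l iter_lie0.
case: N => [/= -> _ _|N hN]; first by rewrite lie0l iter_lie0.
case: N' => [/= -> _|N' hN' NN]; first by rewrite lie0r iter_lie0 lie0r.
rewrite NN iterSr lie_derivr -[lie (lie u x) y]scale1r iter_lieP scale1r.
have k1 : k = (N + N'.+1)%N by lia.
have k2 : k = (N.+1 + N')%N by lia.
rewrite {1}k1 (IH N N'.+1) ?add0r // -?iterSr // k2.
by apply: IH; rewrite -?iterSr.
Qed.

Variables (n : nat) (A : 'M[int]_n) (h : realization K A).
Hypothesis gcmA : gcm A.

(** By the Leibniz rule the vectors killed by a power of ad e_i form a subalgebra, so generators
    suffice: the Serre relations handle the other e_j, while h and the f_j are killed after a few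
    brackets. *)
Lemma chev_e_nil (M : kac_moody h L) i x : ad_nil (chev_e M i) x.
Proof.
have [Aii _ _] := gcmA.
have nil0 u v : lie u v = 0 -> ad_nil u v by exists 1%N.
have nilt t : ad_nil (chev_e M i) (cartan M t).
  by exists 2; rewrite /= (lieC _ (cartan M t)) cartan_e lieNr lieZr lie_alternating scaler0 oppr0.
apply: (km_subalg_ind (M := M) (S := LieSubalg (ad_nil_submod _) (@ad_nil_lie _))) => //= j.
- have [->|ij] := eqVneq i j; first by apply: nil0; rewrite lie_alternating.
  by eexists; apply: (km_serre_e (km_rel M) ij).
- have [c eE] := lie_ef_coroot M i j.
  have [N hN] := nilt (c *: simple_coroot h i).
  by exists N.+1; rewrite iterSr eE.
Qed.

Lemma chev_f_nil (M : kac_moody h L) i x : ad_nil (chev_f M i) x.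
Proof. exact: (chev_e_nil (km_swap M)). Qed.

End Nilpotency.

(** * Invariant forms *)

Section Form.
Variables (K : numFieldType) (n : nat) (A : 'M[int]_n) (h : realization K A).
Variables (L : lieAlgType K).

(** The properties that pass to the restriction to [m] before its nondegeneracy is known. Positivity
    of (e_i, f_i) stands for the normalisation on coroots. *)
Record positive_form (M : kac_moody h L) (F : L -> L -> K) : Prop := PositiveForm {
  pf_linear : forall x, scalar (F x);
  pf_sym : forall x y, F x y = F y x;
  pf_inv : forall x y z, F (lie x y) z = F x (lie y z);
  pf_gt0 : forall i, 0 < F (chev_e M i) (chev_f M i) }.

Lemma positive_form_swap M F : positive_form M F -> positive_form (km_swap M) F.
Proof. by case=> lin sym inv gt0; split=> // i; rewrite sym; apply: gt0. Qed.

Variables (M : kac_moody h L) (F : L -> L -> K).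
Hypothesis posF : positive_form M F.
Notation iota := (cartan M).
Notation e := (chev_e M).
Notation f := (chev_f M).
Notation weight := (weight_space iota).
Local Notation Q := 'rV[int]_n.

Lemma FC x y : F x y = F y x. Proof. exact: pf_sym posF _ _. Qed.
Lemma Finv x y z : F (lie x y) z = F x (lie y z). Proof. exact: pf_inv posF _ _ _. Qed.
Lemma FDr x y z : F x (y + z) = F x y + F x z.
Proof. by have := pf_linear posF x 1 y z; rewrite scale1r mul1r. Qed.
Lemma F0r x : F x 0 = 0.
Proof. by apply: (addrI (F x 0)); rewrite -FDr !addr0. Qed.
Lemma FZr c x y : F x (c *: y) = c * F x y.
Proof. by have := pf_linear posF x c y 0; rewrite addr0 F0r addr0. Qed.
Lemma FDl x y z : F (x + y) z = F x z + F y z.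
Proof. by rewrite ![F _ z]FC FDr. Qed.
Lemma F0l x : F 0 x = 0. Proof. by rewrite FC F0r. Qed.
Lemma FZl c x y : F (c *: x) y = c * F x y. Proof. by rewrite ![F _ y]FC FZr. Qed.
Lemma FNr x y : F x (- y) = - F x y. Proof. by rewrite -scaleN1r FZr mulN1r. Qed.
Lemma FNl x y : F (- x) y = - F x y. Proof. by rewrite FC FNr FC. Qed.
Lemma Fsumr (I : Type) (r : seq I) (P : pred I) (G : I -> L) x :
  F x (\sum_(i <- r | P i) G i) = \sum_(i <- r | P i) F x (G i).
Proof. by elim/big_rec2: _ => [|i _ y _ <-]; rewrite ?F0r ?FDr. Qed.
Lemma Fsuml (I : Type) (r : seq I) (P : pred I) (G : I -> L) x :
  F (\sum_(i <- r | P i) G i) x = \sum_(i <- r | P i) F (G i) x.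
Proof. by rewrite FC Fsumr; apply: eq_bigr => i _; rewrite FC. Qed.

Lemma F_weight (g d : 'Hom(h, K^o)) x y :
  weight g x -> weight d y -> F x y != 0 -> d = - g.
Proof.
move=> wx wy nz; apply/lfunP => t; rewrite opp_lfunE; apply/eqP.
have : F (lie (iota t) x) y + F x (lie (iota t) y) = 0.
  by rewrite lieC FNl Finv addNr.
rewrite wx wy FZl FZr -mulrDl => /eqP; rewrite mulf_eq0 (negbTE nz) orbF.
by rewrite addrC addr_eq0.
Qed.

Definition eps i := F (e i) (f i).
Lemma eps_gt0 i : 0 < eps i. Proof. exact: pf_gt0 posF i. Qed.
Lemma eps_neq0 i : eps i != 0. Proof. by rewrite gt_eqF ?eps_gt0. Qed.
Lemma eps_real i : eps i \is Num.real. Proof. by rewrite gtr0_real ?eps_gt0. Qed.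

Lemma F_coroot i t : F (iota (simple_coroot h i)) (iota t) = (simple_root h i t : K) * eps i.
Proof.
have := lie_ef M i i; rewrite eqxx => <-.
by rewrite Finv lieC cartan_f scaleNr opprK FZr.
Qed.

(** The element of [h] that represents the root [z] through the form. It can be written down on
    coroots because the i-th coroot represents [eps i] times the i-th simple root. *)
Definition tt (z : Q) : h := \sum_i ((z 0 i)%:~R / eps i) *: simple_coroot h i.

Lemma F_tt z t : F (iota (tt z)) (iota t) = rt h z t.
Proof.
rewrite /tt linear_sum /= Fsuml rtE; apply: eq_bigr => i _.
by rewrite linearZ /= FZl F_coroot; field; rewrite eps_neq0.
Qed.

Definition Bf (z w : Q) : K := rt h w (tt z).
Lemma BfE z w : Bf z w = F (iota (tt w)) (iota (tt z)). Proof. by rewrite F_tt. Qed.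
Lemma BfC z w : Bf z w = Bf w z. Proof. by rewrite !BfE FC. Qed.
Lemma BfDr z w v : Bf z (w + v) = Bf z w + Bf z v.
Proof. by rewrite /Bf raddfD add_lfunE. Qed.
Lemma BfNr z w : Bf z (- w) = - Bf z w.
Proof. by rewrite /Bf raddfN opp_lfunE. Qed.
Lemma BfDl z w v : Bf (w + v) z = Bf w z + Bf v z.
Proof. by rewrite ![Bf _ z]BfC BfDr. Qed.
Lemma BfNl z w : Bf (- w) z = - Bf w z.
Proof. by rewrite ![Bf _ z]BfC BfNr. Qed.
Lemma Bfzr z w k : Bf z (w *~ k) = k%:~R * Bf z w.
Proof.
by rewrite /Bf raddfMz -scaler_int scale_lfunE.
Qed.
Lemma Bfzl z w k : Bf (w *~ k) z = k%:~R * Bf w z.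
Proof. by rewrite ![Bf _ z]BfC Bfzr. Qed.

(** The pairing of [z] with the i-th coroot, kept in [int] so that simple reflections act on the
    lattice. *)
Definition ci (i : 'I_n) (z : Q) : int := \sum_j A i j * z 0 j.
Fact ci_is_zmod_morphism i : zmod_morphism (ci i).
Proof.
by move=> y z; rewrite /ci -sumrB; apply: eq_bigr => k _; rewrite !mxE mulrBr.
Qed.
HB.instance Definition _ i := GRing.isZmodMorphism.Build _ _ (ci i) (ci_is_zmod_morphism i).

Lemma rt_coroot z i : rt h z (simple_coroot h i) = (ci i z)%:~R :> K.
Proof.
rewrite rtE /ci rmorph_sum; apply: eq_bigr => j _ /=.
by rewrite rz_pairing -intrM mulrC.
Qed.
Lemma tt_dl i : tt (dl i) = (eps i)^-1 *: simple_coroot h i.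
Proof.
rewrite /tt (bigD1 i) //= big1 => [|k ki].
  by rewrite mxE !eqxx addr0 mul1r.
by rewrite mxE eqxx (negbTE ki) mul0r scale0r.
Qed.
Lemma Bf_dl i z : Bf (dl i) z = (ci i z)%:~R / eps i.
Proof. by rewrite /Bf tt_dl linearZ /= rt_coroot mulrC. Qed.
Lemma ci_dl i j : ci i (dl j) = A i j.
Proof.
rewrite /ci (bigD1 j) //= big1 => [|k kj]; last by rewrite mxE eqxx (negbTE kj) mulr0.
by rewrite mxE !eqxx mulr1 addr0.
Qed.
Lemma Bf_suml z w : Bf z w = \sum_i (z 0 i)%:~R * Bf (dl i) w.
Proof.
rewrite {1}/Bf /tt linear_sum; apply: eq_bigr => i _ /=.
rewrite linearZ /= rt_coroot Bf_dl.
transitivity ((z 0 i)%:~R / eps i * (ci i w)%:~R); first by [].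
by rewrite -mulrA [_^-1 * _]mulrC.
Qed.
Lemma Bf_real z w : Bf z w \is Num.real.
Proof.
rewrite Bf_suml; apply: rpred_sum => i _.
by rewrite Bf_dl !realM ?realV ?eps_real ?realz.
Qed.

(** An element orthogonal to [h] is orthogonal to the coroots, hence killed by all simple roots. By
    the dimension of a minimal realization the common kernel of the simple roots lies in the span of
    the coroots. There the pairing with s is a combination of the values of the simple roots at s,
    and their independence finishes. *)
Lemma cartan_nondeg t : (forall s, F (iota t) (iota s) = 0) -> t = 0.
Proof.
move=> t0.
have at0 i : simple_root h i t = 0 :> K.
  have := t0 (tt (dl i)); rewrite FC F_tt rt_dl; exact.
set d := \dim {:h}.
pose bv := vbasis {:h}.
pose Cm : 'M[K]_(n, d) := \matrix_(i, k) coord bv k (simple_coroot h i).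
pose Rm : 'M[K]_(d, n) := \matrix_(k, i) (simple_root h i bv`_k : K).
pose tv : 'rV[K]_d := \row_k coord bv k t.
have rowE (s : h) i : simple_root h i s = \sum_k coord bv k s * Rm k i :> K.
  rewrite {1}(coord_vbasis (memvf s)) linear_sum; apply: eq_bigr => k _.
  by rewrite linearZ /= [Rm _ _]mxE.
have CR : Cm *m Rm = map_mx intr A.
  apply/matrixP => i k; rewrite !mxE -(rz_pairing h i k) rowE.
  by apply: eq_bigr => l _; rewrite !mxE.
have tR : tv *m Rm = 0.
  apply/rowP => i; rewrite !mxE -[RHS](at0 i) rowE.
  by apply: eq_bigr => l _; rewrite !mxE.
have fC : row_free Cm.
  rewrite -kermx_eq0; apply/eqP/row_matrixP => l; rewrite row0.
  apply/rowP => i; rewrite [LHS]mxE [RHS]mxE.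
  apply: (coroots_indep (h := h) (x := fun i => kermx Cm l i)).
  rewrite (coord_vbasis (memvf (\sum_i0 _))); apply: big1 => k _.
  rewrite linear_sum /=.
  have := mulmx_ker Cm => /matrixP /(_ l k); rewrite [LHS]mxE [RHS]mxE => kk.
  rewrite (eq_bigr (fun j => kermx Cm l j * Cm j k)) ?kk ?scale0r // => j _.
  by rewrite linearZ /= [Cm _ _]mxE.
have fR : \rank Rm = n.
  rewrite -mxrank_tr; apply/eqP; rewrite -/(row_free _) -kermx_eq0.
  apply/eqP/row_matrixP => l; rewrite row0; apply/rowP => i; rewrite [LHS]mxE [RHS]mxE.
  apply: (simple_roots_indep (h := h) (x := fun i => kermx Rm^T l i)) => s.
  under eq_bigr do rewrite rowE mulr_sumr.
  rewrite exchange_big big1 // => k _ /=.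
  have := mulmx_ker Rm^T => /matrixP /(_ l k); rewrite [LHS]mxE [RHS]mxE => kk.
  transitivity (coord bv k s * \sum_j kermx Rm^T l j * Rm^T j k); last by rewrite kk mulr0.
  by rewrite mulr_sumr; apply: eq_bigr => j _; rewrite [Rm^T _ _]mxE; ring.
have sub : (kermx (map_mx intr A : 'M[K]_n) *m Cm <= kermx Rm)%MS.
  by apply/sub_kermxP; rewrite -mulmxA CR mulmx_ker.
(* Both spaces have dimension n minus the rank of A, so the inclusion [sub] is an equality. *)
have : (kermx Rm <= kermx (map_mx intr A : 'M[K]_n) *m Cm)%MS.
  rewrite -(mxrank_leqif_sup sub) mxrankMfree // !mxrank_ker fR /d rz_dim.
  by rewrite addnC addnK.
move/(submx_trans (introT sub_kermxP tR)) => /submxP [w].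
rewrite mulmxA; set x := w *m _ => tvE.
have tE : t = \sum_i x 0 i *: simple_coroot h i.
  rewrite [LHS](coord_vbasis (memvf t)) [RHS](coord_vbasis (memvf _)); apply: eq_bigr => k _; congr (_ *: _).
  have : tv 0 k = (x *m Cm) 0 k by rewrite tvE.
  rewrite [LHS]mxE [RHS]mxE linear_sum /= => ->; apply: eq_bigr => j _.
  by rewrite linearZ /= [Cm _ _]mxE.
have xe0 i : x 0 i * eps i = 0.
  apply: (simple_roots_indep (h := h) (x := fun i => x 0 i * eps i)) => s.
  rewrite -[RHS](t0 s) tE linear_sum Fsuml /=; apply: eq_bigr => j _.
  by rewrite linearZ /= FZl F_coroot; ring.
rewrite tE big1 // => i _.
by have /eqP := xe0 i; rewrite mulf_eq0 (negbTE (eps_neq0 i)) orbF => /eqP ->; rewrite scale0r.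
Qed.

Lemma lie_opp_weights z x y : weight (rt h z) x -> weight (rt h (- z)) y ->
  lie x y = F x y *: iota (tt z).
Proof.
move=> wx wy; have := weight_lie wx wy; rewrite -raddfD subrr => /weight_zero [t xyE].
rewrite xyE -[_ *: _](linearZ_LR iota) /=; congr (iota _).
apply/eqP; rewrite -subr_eq0; apply/eqP; apply: cartan_nondeg => s.
rewrite linearB linearZ /= -scaleNr FDl FZl F_tt mulNr -xyE Finv lieC wy.
by rewrite -scaleNr FZr raddfN opp_lfunE opprK mulrC subrr.
Qed.

(** For equal lengths and distinct contents both sides vanish: the difference of the contents is
    nonzero of height 0, so it has coordinates of both signs and is not a weight. *)
Lemma lie_words s s' : size s = size s' ->
  lie (word e s) (word f s') = F (word e s) (word f s') *: iota (tt (content s)).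
Proof.
move=> ss; have we := weight_word_e M s; have wf := weight_word_f M s'.
have [c|c] := eqVneq (content s) (content s').
  by apply: lie_opp_weights => //; rewrite c.
have -> : F (word e s) (word f s') = 0.
  apply: contraNeq c => /(F_weight we wf); rewrite -raddfN => /rt_inj /oppr_inj ->.
  exact: eqxx.
have h0 : ht (content s - content s') = 0 by rewrite htD htN !ht_content ss subrr.
rewrite scale0r; apply: (weight_mixed (M := M) (z := content s - content s')).
- by rewrite raddfD; apply: weight_lie.
- by apply/negP => /ht_eq0; rewrite h0 eqxx subr_eq0 (negbTE c).
- by apply/negP => /ht_eq0; rewrite htN h0 oppr0 eqxx oppr_eq0 subr_eq0 (negbTE c).
Qed.

End Form.

Ltac entry_lia := rewrite /= ?mxE /= -?leNgt;
  repeat match goal with |- context [fun_of_matrix ?M ?i ?j] =>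
    move: (fun_of_matrix M i j) => ? end; lia.

(** * Roots of positive norm *)

Section Roots.
Variables (K : numFieldType) (n : nat) (A : 'M[int]_n) (h : realization K A).
Variables (L : lieAlgType K) (M : kac_moody h L) (F : L -> L -> K).
Hypotheses (gcmA : gcm A) (posF : positive_form M F).
Notation iota := (cartan M).
Notation e := (chev_e M).
Notation f := (chev_f M).
Notation weight := (weight_space iota).
Local Notation Q := 'rV[int]_n.
Local Notation Bf := (Bf M F).

Let Aii i : A i i = 2. Proof. by case: gcmA. Qed.

(** Zero qualifies as soon as [h] is nonzero, hence the separate conditions [z != 0] below. *)
Definition isroot (z : Q) := exists2 x, weight (rt h z) x & x != 0.

Lemma root_sign z : isroot z -> zge0 z \/ zge0 (- z).
Proof.
case=> x wx; case: (boolP (zge0 z)) => [|z1]; first by left.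
case: (boolP (zge0 (- z))) => [|z2]; first by right.
by rewrite (weight_mixed wx z1 z2) eqxx.
Qed.

Lemma root_refl i z : isroot z -> isroot (z - dl i *~ ci A i z).
Proof.
case=> x wx x0.
have we : weight (rt h (dl i)) (e i) by exact: weight_e.
have wf : weight (- rt h (dl i)) (f i) by rewrite -raddfN; exact: weight_f.
have ef : lie (e i) (f i) = iota (simple_coroot h i) by rewrite lie_ef eqxx.
have al2 : rt h (dl i) (simple_coroot h i) = 2 :> K by rewrite rt_coroot ci_dl Aii.
have [k|k|c [cE [y wy y0]]] := weight_reflect we wf ef al2 wx x0.
- exact: chev_f_nil.
- exact: chev_e_nil.
exists y => //; move: cE; rewrite rt_coroot => /intr_inj ->.
by rewrite raddfB raddfMz.
Qed.

Lemma highest_ci i z x : weight (rt h z) x -> x != 0 -> lie (e i) x = 0 ->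
  0 <= ci A i z /\ (ci A i z = 0 -> lie (f i) x = 0).
Proof.
move=> wx x0 ex.
have ef : lie (e i) (f i) = iota (simple_coroot h i) by rewrite lie_ef eqxx.
have cf : lie (iota (simple_coroot h i)) (f i) = - 2 *: f i.
  by rewrite cartan_f rz_pairing Aii.
have [k [ck _ fk]] := sl2_highest ef cf (wx _) ex x0 (chev_f_nil gcmA M i x).
have {}ck : ci A i z = k%:Z by apply: (@intr_inj K); rewrite -(rt_coroot h) ck.
split=> [|c0]; first by rewrite ck.
by move: ck fk; rewrite c0 => -[<-].
Qed.

Lemma root_top i z x : weight (rt h z) x -> x != 0 -> ~ isroot (z + dl i) ->
  0 <= ci A i z /\ (ci A i z = 0 -> lie (f i) x = 0).
Proof.
move=> wx x0 nr; apply: highest_ci => //.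
apply: contrapT => /eqP nz; apply: nr; exists (lie (e i) x) => //.
by rewrite addrC raddfD; apply: weight_lie wx; exact: weight_e.
Qed.

(** Letters outside [J] commute with letters in [J], so the first letter in [J] can be pulled to the
    front. *)
Lemma word_first (J : pred 'I_n) s : has J s ->
  (forall l j, l \in s -> ~~ J l -> J j -> lie (f l) (f j) = 0) ->
  exists2 j, J j & (word f s = f j) \/ exists w, word f s = lie (f j) w.
Proof.
elim: s => // l s IH hs hl.
have [s0|s0] := eqVneq s [::].
  by move: hs; rewrite s0 /= orbF => Jl; exists l => //; left.
rewrite word_cons //; move: hs => /= /orP hs.
have [Jl|Jl] := boolP (J l); first by exists l => //; right; exists (word f s).
case: hs => [Jl'|hs]; first by rewrite Jl' in Jl.
have [k j ks|j Jj] := IH hs; first by apply: hl; rewrite inE ks orbT.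
have lj : lie (f l) (f j) = 0 by apply: hl => //; rewrite inE eqxx.
case=> [->|[w ->]]; exists j => //; right; first by exists 0; rewrite lj lie0r.
by exists (lie (f l) w); rewrite lie_derivr lj lie0l add0r.
Qed.

Hypothesis nondeg : forall x, (forall y, F x y = 0) -> x = 0.

Lemma root_dual z x : weight (rt h z) x -> x != 0 -> z != 0 ->
  exists y, [/\ F x y != 0, weight (rt h (- z)) y
    & (exists2 s, y = word e s & content s = - z) \/
      (exists2 s, y = word f s & content s = z)].
Proof.
move=> wx x0 z0.
have [y ty xy] : exists2 y, triang M y & F x y != 0.
  apply: contrapT => hn; case/eqP: x0; apply: nondeg => y.
  refine (lspan_sub (P := fun y => F x y = 0) _ _ (triang_span (M := M) y)).
    split=> [|c u v hu hv]; first exact: F0r posF _.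
    by rewrite (FDr posF) (FZr posF) hu hv mulr0 addr0.
  by move=> w tw; apply: contrapT => /eqP nz; apply: hn; exists w.
exists y; move: ty xy; case=> [[t ->]|[s ->]|[s ->]] xy.
- have := F_weight posF wx (weight_cartan M t) xy.
  by rewrite -raddfN => /rt_inj /eqP; rewrite eq_sym oppr_eq0 (negbTE z0).
- have := F_weight posF wx (weight_word_e M s) xy.
  rewrite -raddfN => /rt_inj sz; split=> //; last by left; exists s.
  by rewrite -sz; exact: weight_word_e.
- have := F_weight posF wx (weight_word_f M s) xy.
  rewrite -raddfN => /rt_inj sz; split=> //; last by right; exists s => //; apply: oppr_inj.
  by rewrite -sz; exact: weight_word_f.
Qed.

Lemma root_opp z : isroot z -> z != 0 -> isroot (- z).
Proof.
case=> x wx x0 z0; have [y [xy wy _]] := root_dual wx x0 z0.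
by exists y => //; apply: contraNneq xy => ->; rewrite (F0r posF).
Qed.

(** Suppose that b can be raised by no alpha_i with i in J, the support of eta = 2z - b. Then b
    pairs nonnegatively with the coroots in J and eta nonpositively. Let b_J be the part of b
    supported on J. Summing eta_j (b_J, alpha_j) in two ways shows that b_J is orthogonal to every
    alpha_j in J, so J is cut off from the rest of the support of b, and each f_j with j in J kills
    the root vector x. But x pairs nontrivially with a negative word of content b, which can be made
    to start with such an f_j. *)
Lemma antidominant_step z b : zge0 z -> z != 0 -> (forall i, ci A i z <= 0) ->
  isroot b -> zge0 (b - z) -> zge0 (z + z - b) -> b != z + z ->
  exists2 i, b 0 i < (z + z) 0 i & isroot (b + dl i).
Proof.
move=> z0 zn0 cz rb /zge0P bz /zge0P eta0 bzz; apply: contrapT => hn.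
have nr i : b 0 i < (z + z) 0 i -> ~ isroot (b + dl i) by move=> hi ri; apply: hn; exists i.
have [x wx x0] := rb.
pose J := [pred i | b 0 i < (z + z) 0 i].
pose eta := z + z - b.
have etaJ i : ~~ J i -> eta 0 i = 0.
  by move: (eta0 i); rewrite /eta /J; entry_lia.
have bi0 i : 0 <= b 0 i by have := bz i; move/zge0P: z0 => /(_ i); entry_lia.
have biJ i : J i -> 0 < b 0 i.
  by have := bz i; move/zge0P: z0 => /(_ i); entry_lia.
have cJ i : J i -> 0 <= ci A i b.
  by move=> Ji; case: (root_top wx x0 (nr i Ji)).
pose inner j : K := \sum_(i | J i) (b 0 i)%:~R * Bf (dl i) (dl j).
have bneg l j : l != j -> Bf (dl l) (dl j) <= 0.
  move=> lj; rewrite Bf_dl ci_dl; apply: mulr_le0_ge0.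
    by rewrite lerz0; case: gcmA => _ + _; apply.
  by rewrite invr_ge0 ltW ?(eps_gt0 posF).
have innerE j : inner j = Bf b (dl j) + \sum_(l | ~~ J l) - ((b 0 l)%:~R * Bf (dl l) (dl j)).
  by rewrite (Bf_suml M F b) (bigID J) /= sumrN addrK.
have innerA j : J j -> 0 <= Bf b (dl j).
  move=> Jj; rewrite (BfC posF) Bf_dl mulr_ge0 ?ler0z ?cJ //.
  by rewrite invr_ge0 ltW ?(eps_gt0 posF).
have innerB j : J j -> forall l, ~~ J l -> 0 <= - ((b 0 l)%:~R * Bf (dl l) (dl j)).
  move=> Jj l Jl; rewrite -mulrN mulr_ge0 ?ler0z ?bi0 // oppr_ge0 bneg //.
  by apply: contraNneq Jl => ->.
have inner0 j : J j -> 0 <= inner j.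
  by move=> Jj; rewrite innerE addr_ge0 ?innerA // sumr_ge0 // => l; apply: innerB.
have etaE i : Bf (dl i) eta = \sum_(j | J j) (eta 0 j)%:~R * Bf (dl i) (dl j).
  rewrite (BfC posF) (Bf_suml M F eta) (bigID J) /= [X in _ + X]big1 ?addr0.
    by apply: eq_bigr => j _; rewrite (BfC posF).
  by move=> j /etaJ ->; rewrite mul0r.
(* Exchanging the sums gives the sum of b_i (alpha_i, eta) over J, where each factor (alpha_i, eta)
   is nonpositive: z is antidominant and b is nonnegative on J. *)
have T0 : \sum_(j | J j) (eta 0 j)%:~R * inner j <= 0.
  have -> : \sum_(j | J j) (eta 0 j)%:~R * inner j = \sum_(i | J i) (b 0 i)%:~R * Bf (dl i) eta.
    under eq_bigr do rewrite mulr_sumr.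
    rewrite exchange_big /=; apply: eq_bigr => i Ji.
    by rewrite etaE mulr_sumr; apply: eq_bigr => j Jj; ring.
  apply: sumr_le0 => i Ji; apply: mulr_ge0_le0; first by rewrite ler0z.
  rewrite Bf_dl; apply: mulr_le0_ge0; last by rewrite invr_ge0 ltW ?(eps_gt0 posF).
  rewrite lerz0 /eta raddfB raddfD /=.
  by have := cJ _ Ji; have := cz i; lia.
have eta_ge j : 0 <= (eta 0 j)%:~R :> K by rewrite ler0z; apply: eta0.
have innereq0 j : J j -> inner j = 0.
  move=> Jj.
  have pos k : J k -> 0 <= (eta 0 k)%:~R * inner k by move=> Jk; exact: mulr_ge0 (eta_ge k) (inner0 k Jk).
  have T1 : \sum_(j | J j) (eta 0 j)%:~R * inner j = 0.
    by apply/eqP; rewrite eq_le T0 sumr_ge0.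
  have /eqP := psumr_eq0P pos T1 Jj.
  rewrite mulf_eq0 intr_eq0 => /orP [|/eqP //].
  by move: Jj; rewrite /J /eta; entry_lia.
have cJ0 j : J j -> ci A j b = 0.
  move=> Jj; have /eqP := innereq0 j Jj; rewrite innerE paddr_eq0 ?innerA ?sumr_ge0 //; last exact: innerB.
  case/andP; rewrite (BfC posF) Bf_dl mulf_eq0 invr_eq0 (negbTE (eps_neq0 posF j)) orbF.
  by rewrite intr_eq0 => /eqP.
have ff l j : b 0 l != 0 -> ~~ J l -> J j -> lie (f l) (f j) = 0.
  move=> bl Jl Jj; have /eqP := innereq0 j Jj; rewrite innerE paddr_eq0 ?innerA ?sumr_ge0 //; last exact: innerB.
  case/andP=> _ /eqP /(psumr_eq0P (innerB j Jj)) /(_ l Jl) /eqP.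
  rewrite oppr_eq0 mulf_eq0 intr_eq0 (negbTE bl) /= Bf_dl mulf_eq0.
  rewrite invr_eq0 (negbTE (eps_neq0 posF l)) orbF ci_dl intr_eq0 => /eqP Alj.
  have lj : l != j by apply: contraNneq Jl => ->.
  by have := km_serre_f (km_rel M) lj; rewrite Alj.
have b0 : b != 0.
  apply: contraNneq zn0 => b0; apply/eqP/rowP => i; move: (bz i).
  by rewrite b0; move/zge0P: z0 => /(_ i); entry_lia.
(* A positive word would give -b as its content, which is excluded because b is positive and
   nonzero. *)
have [y [xy _ [[s ys sb]|[s ys sb]]]] := root_dual wx x0 b0.
  case/eqP: b0; apply: zge0_anti; first by apply/zge0P.
  by rewrite -sb content_ge0.
have hasJ : has J s.
  have [i Ji] : exists i, J i.
    apply: contrapT => hJ; case/eqP: bzz; apply/rowP => i.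
    have /negP /etaJ : ~ J i by move=> Ji; apply: hJ; exists i.
    by rewrite /eta; entry_lia.
  apply/hasP; exists i => //; have := biJ i Ji.
  by rewrite -sb contentE -has_pred1 has_count; lia.
have [l j ls|j Jj hj] := word_first hasJ.
  by apply: ff; rewrite -sb contentE; move: ls; rewrite -has_pred1 has_count; lia.
have fx : lie (f j) x = 0 by case: (root_top wx x0 (nr j Jj)) => _; apply; apply: cJ0.
move: xy; rewrite ys; case: hj => [wE|[w ->]]; last first.
  by rewrite -(Finv posF) lieC fx oppr0 (F0l posF) eqxx.
rewrite wE => /(F_weight posF wx (weight_f M j)); rewrite -raddfN => /rt_inj /oppr_inj jb.
by have := cJ0 j Jj; rewrite -jb ci_dl Aii.
Qed.

Lemma root_double z : isroot z -> zge0 z -> z != 0 -> (forall i, ci A i z <= 0) ->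
  isroot (z + z).
Proof.
move=> rz z0 zn0 cz.
suff H k b : isroot b -> zge0 (b - z) -> zge0 (z + z - b) -> ht (z + z - b) = k%:Z -> isroot (z + z).
  have zz : zge0 (z + z - z) by rewrite addrK.
  apply: (H `|ht (z + z - z)|%N z) => //; first by rewrite subrr; apply/zge0P => i; rewrite mxE.
  by rewrite gez0_abs ?ht_ge0.
elim: k b => [|k IH] b rb bz eta0 hk.
  by move/eqP: hk; rewrite ht_eq0 // subr_eq0 => /eqP ->.
have [<- //|bzz] := eqVneq b (z + z).
have [i hi ri] := antidominant_step z0 zn0 cz rb bz eta0 bzz.
apply: (IH (b + dl i)) => //.
- apply/zge0P => j; move/zge0P: bz => /(_ j); rewrite !mxE /=; case: (j == i); entry_lia.
- apply/zge0P => j; move/zge0P: eta0 => /(_ j); move: hi; rewrite !mxE /=; have [->|_] := eqVneq j i; entry_lia.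
by rewrite opprD addrA htD htN ht_dl hk; lia.
Qed.

Lemma Bf_refl i z : Bf (z - dl i *~ ci A i z) (z - dl i *~ ci A i z) = Bf z z.
Proof.
rewrite !(BfDr, BfDl posF, BfNr, BfNl posF) !(Bfzr, Bfzl posF).
rewrite (BfC posF z (dl i)) !Bf_dl ci_dl Aii.
by field; rewrite (eps_neq0 posF).
Qed.

Lemma refl_refl i z : let z' := z - dl i *~ ci A i z in z' - dl i *~ ci A i z' = z.
Proof.
rewrite /= raddfB raddfMz /= ci_dl Aii.
have -> : ci A i z - 2 *~ ci A i z = - ci A i z by rewrite -mulrzr; lia.
by rewrite mulrNz opprK addrNK.
Qed.

Lemma reflMn i z k : (z *+ k) - dl i *~ ci A i (z *+ k) = (z - dl i *~ ci A i z) *+ k.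
Proof. by rewrite mulrnBl raddfMn /= -mulr_natr mulrzA natz. Qed.

Lemma zge0Mn (z : Q) k : zge0 z -> zge0 (z *+ k).
Proof. by move/zge0P => z0; apply/zge0P => i; rewrite mulmxnE mulrn_wge0. Qed.

Lemma mul2n_neq0 (z : Q) k : z != 0 -> z *+ 2 ^ k != 0.
Proof.
apply: contraNneq => /rowP z0; apply/eqP/rowP => i.
have /eqP := z0 i; rewrite mulmxnE !mxE mulrn_eq0 expn_eq0 /= => /eqP; exact.
Qed.

Lemma root_doubles z : isroot z -> zge0 z -> z != 0 -> (forall i, ci A i z <= 0) ->
  forall k, isroot (z *+ 2 ^ k).
Proof.
move=> rz z0 zn0 cz; elim=> [|k IH]; first by rewrite expn0 mulr1n.
rewrite expnS mulnC mulrnA mulr2n; apply: root_double => //.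
- exact: zge0Mn.
- exact: mul2n_neq0.
- by move=> i; rewrite raddfMn /= mulrn_wle0.
Qed.

Lemma Bf_dl_mul i c : c != 0 -> 0 < Bf (dl i *~ c) (dl i *~ c).
Proof.
move=> c0; rewrite (Bfzr M F) (Bfzl posF) Bf_dl ci_dl Aii mulrA -expr2.
apply: mulr_gt0; last by rewrite divr_gt0 ?(eps_gt0 posF).
by rewrite real_exprn_even_gt0 ?realz //= intr_eq0.
Qed.

Lemma real_or_double z : isroot z -> z != 0 ->
  0 < Bf z z \/ forall k, isroot (z *+ 2 ^ k).
Proof.
suff H k z' : ht z' = k%:Z -> zge0 z' -> isroot z' -> z' != 0 ->
    0 < Bf z' z' \/ forall k, isroot (z' *+ 2 ^ k).
  move=> rz zn0; have [z0|z0] := root_sign rz.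
    by apply: (H `|ht z|%N) => //; rewrite gez0_abs ?ht_ge0.
  have nz0 : - z != 0 by rewrite oppr_eq0.
  have [] := H `|ht (- z)|%N (- z) _ z0 (root_opp rz zn0) nz0.
  - by rewrite gez0_abs ?ht_ge0.
  - by rewrite BfNr (BfNl posF) opprK; left.
  - move=> hz; right => k; rewrite -[z]opprK mulNrn; apply: root_opp => //.
    exact: mul2n_neq0.
elim/ltn_ind: k z' => k IH {}z hk z0 rz zn0.
have [cz|] := pselect (forall i, ci A i z <= 0); first by right; apply: root_doubles.
move/existsNP => [i /negP]; rewrite -ltNge => ci0.
have [zi|zi] := eqVneq z (dl i *~ z 0 i).
  left; rewrite zi; apply: Bf_dl_mul.
  by apply: contraNneq zn0 => z00; rewrite zi z00 mulr0z.
pose z' := z - dl i *~ ci A i z.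
have z'E j : j != i -> z' 0 j = z 0 j.
  by move=> ji; rewrite /z' !mxE -scaler_int !mxE eqxx (negbTE ji) mulr0 subr0.
have rz' : isroot z' by exact: root_refl.
have off (y : Q) : (forall j, j != i -> y 0 j = 0) -> y = dl i *~ y 0 i.
  move=> yj; apply/rowP => j; rewrite -scaler_int !mxE eqxx /=.
  by have [->|/yj ->] := eqVneq j i; rewrite ?mulr1 ?mulr0 // intz.
(* The reflection changes only the i-th coordinate. Were the result negative, all other coordinates
   of z would vanish and z would be a multiple of alpha_i. *)
have z'0 : zge0 z'.
  have [//|/zge0P z'n] := root_sign rz'; case/eqP: zi; apply: off => j ji.
  by have := z'n j; move/zge0P: z0 => /(_ j); rewrite mxE z'E //; entry_lia.
have z'n0 : z' != 0.
  apply: contraNneq zi => z'0'; apply/eqP/off => j ji.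
  by rewrite -z'E // z'0' mxE.
have hz' : ht z' = ht z - ci A i z.
  rewrite /z' htD htN; congr (_ - _).
  rewrite /ht (bigD1 i) //= big1 => [|j ji].
    by rewrite -scaler_int !mxE !eqxx mulr1 addr0 intz.
  by rewrite -scaler_int !mxE eqxx (negbTE ji) mulr0.
have := ht_ge0 z'0; rewrite hz' hk => hz0.
have lt : (`|ht z'| < k)%N by rewrite hz' hk; lia.
have [] := IH _ lt z' _ z'0 rz' z'n0; first by rewrite gez0_abs ?ht_ge0.
  by rewrite Bf_refl; left.
move=> H; right => l; have := root_refl i (H l).
by rewrite reflMn refl_refl.
Qed.

End Roots.

(** * Finite subsystems of roots and averaging over them *)

Section FiniteSubsystem.
Variables (K : numFieldType) (n : nat) (A : 'M[int]_n) (h : realization K A).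
Variables (L : lieAlgType K) (M : kac_moody h L) (F : L -> L -> K).
Hypotheses (gcmA : gcm A) (posF : positive_form M F).
Hypothesis nondeg : forall x, (forall y, F x y = 0) -> x = 0.
Notation iota := (cartan M).
Notation weight := (weight_space iota).
Local Notation Q := 'rV[int]_n.
Local Notation Bf := (Bf M F).
Local Notation tt := (tt M F).
Local Notation isroot := (isroot M).

(** [P] is a subgroup of the root lattice and [s] lists the nonzero roots in it. Later [P] collects
    the vectors that restrict to integral multiples of one simple root of [m]. *)
Variables (P : Q -> Prop) (s : seq Q).
Hypotheses (P0 : P 0) (PB : forall y z, P y -> P z -> P (y - z)).
Hypotheses (us : uniq s).
Hypothesis sP : forall z, z \in s <-> [/\ P z, z != 0 & isroot z].

Let PN z : P z -> P (- z). Proof. by rewrite -[- z]add0r; apply: PB. Qed.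
Let PD y z : P y -> P z -> P (y + z).
Proof. by move=> py pz; rewrite -[z]opprK; apply: PB => //; apply: PN. Qed.
Let PMn z k : P z -> P (z *+ k).
Proof. by move=> pz; elim: k => [|k IH]; rewrite ?mulr0n // mulrS; apply: PD. Qed.
Let PMz z k : P z -> P (z *~ k).
Proof.
by move=> pz; case: k => k; [exact: PMn|rewrite NegzE mulrNz; apply/PN/PMn].
Qed.

Let natmul_inj (z : Q) k l : z != 0 -> z *+ k = z *+ l -> k = l.
Proof.
move=> zn0 /rowP kl; apply: contrapT => nkl; case/eqP: zn0; apply/rowP => i.
have E (c : int) q : c *+ q = c * q%:Z by rewrite -mulr_natr natz.
rewrite [RHS]mxE; have := kl i; rewrite !mulmxnE => /eqP; rewrite !E -subr_eq0 -mulrBr.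
by rewrite mulf_eq0 subr_eq0 => /orP [/eqP //|/eqP [] /nkl].
Qed.

Lemma sub_norm_gt0 z : z \in s -> 0 < Bf z z.
Proof.
move/sP => [Pz zn0 rz]; have [//|rk] := real_or_double gcmA posF nondeg rz zn0.
have /uniq_leq_size : uniq [seq z *+ 2 ^ k | k <- seq.iota 0 (size s).+1].
  rewrite map_inj_uniq ?iota_uniq // => k l /(natmul_inj zn0) /eqP.
  by rewrite eqn_exp2l // => /eqP.
move=> /(_ s) hs; suff /hs : {subset [seq z *+ 2 ^ k | k <- seq.iota 0 (size s).+1] <= s}.
  by rewrite size_map size_iota ltnn.
move=> _ /mapP [k _ ->]; apply/sP; split=> //; first exact: PMn.
exact: mul2n_neq0.
Qed.

Lemma sub_opp z : z \in s -> - z \in s.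
Proof.
move/sP => [Pz zn0 rz]; apply/sP; split; first exact: PN.
  by rewrite oppr_eq0.
exact: (root_opp posF nondeg).
Qed.

(** The weights u + kz stay in [P], where zero and the finite list [s] are the only weights
    available. *)
Lemma sub_nil z x u v : z \in s -> weight (rt h z) x -> P u -> weight (rt h u) v ->
  ad_nil x v.
Proof.
move/sP => [Pz zn0 _] wx Pu wv; apply: contrapT => nn.
(* [(size s).+2] is one more than the size of [0 :: s]. *)
have /uniq_leq_size : uniq [seq u + z *+ k | k <- seq.iota 0 (size s).+2].
  by rewrite map_inj_uniq ?iota_uniq // => k l /addrI /(natmul_inj zn0).
move=> /(_ (0 :: s)) hs.
suff /hs : {subset [seq u + z *+ k | k <- seq.iota 0 (size s).+2] <= 0 :: s}.
  by rewrite size_map size_iota ltnn.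
move=> _ /mapP [k _ ->]; rewrite inE.
have [//|kn0 /=] := eqVneq (u + z *+ k) 0.
apply/sP; split=> //; first by apply: PD => //; apply: PMn.
exists (iter k (lie x) v); last by apply/eqP => k0; apply: nn; exists k.
by rewrite raddfD raddfMn; apply: weight_iter_lie.
Qed.

Lemma sub_refl z w : z \in s -> w \in s ->
  exists q : int, 2 * Bf z w / Bf z z = q%:~R /\ w - z *~ q \in s.
Proof.
move=> zs ws; have [Pz zn0 [x wx x0]] := (sP z).1 zs.
have [Pw wn0 [v wv v0]] := (sP w).1 ws.
have [y [xy wy _]] := root_dual posF nondeg wx x0 zn0.
have Bn0 : Bf z z != 0 by rewrite gt_eqF ?sub_norm_gt0.
(* Scaled so that [x, f] is 2 [tt z] / (z, z), the coroot of z; the positive norm of z is what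
   permits the division. *)
pose f := (2 / (Bf z z * F x y)) *: y.
pose d := (2 / Bf z z) *: tt z.
have wf : weight (- rt h z) f by rewrite -raddfN; exact: weightZ.
have ef : lie x f = iota d.
  rewrite /f lieZr (lie_opp_weights posF wx wy) scalerA /d linearZ /=.
  by congr (_ *: _); field; rewrite Bn0 xy.
have zd : rt h z d = 2 :> K.
  rewrite /d linearZ /= -/(Bf z z); transitivity (2 / Bf z z * Bf z z); first by [].
  by rewrite divfK.
have [k|k|q [qE [v' wv' v'0]]] := weight_reflect wx wf ef zd wv v0.
- apply: (sub_nil (sub_opp zs) (u := w + z *+ k)).
  + by rewrite raddfN.
  + by apply: PD => //; apply: PMn.
  + by rewrite raddfD raddfMn; apply: weight_iter_lie.
- apply: (sub_nil zs wx (u := w - z *+ k)).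
  + by apply: PB => //; apply: PMn.
  + by rewrite raddfB raddfMn -mulNrn; apply: weight_iter_lie.
exists q; have qE' : 2 * Bf z w / Bf z z = q%:~R.
  rewrite -qE /d linearZ /= -/(Bf z w).
  transitivity (2 / Bf z z * Bf z w); last by [].
  by field.
split=> //; apply/sP; split.
- by apply: PB => //; apply: PMz.
- apply: contraNneq wn0 => /eqP; rewrite subr_eq0 => /eqP wE.
  move: qE'; rewrite {1}wE (Bfzr M F) => qq.
  have : 2 * q%:~R = q%:~R :> K by rewrite -[RHS]qq; field.
  move/eqP; rewrite -subr_eq0 mulr_natl mulr2n addrK intr_eq0 => /eqP q0.
  by rewrite wE q0 mulr0z.
- by exists v' => //; rewrite raddfB raddfMz.
Qed.

(** The eigenvalue at a of the operator that sends x to the sum of (b, x) b over S, read off by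
    pairing with a. *)
Definition lam a : K := \sum_(b <- s) Bf b a ^+ 2 / Bf a a.

Lemma lam_gt0 a : a \in s -> 0 < lam a.
Proof.
move=> sa; have Ba := sub_norm_gt0 sa.
have term b : 0 <= Bf b a ^+ 2 / Bf a a.
  by rewrite divr_ge0 ?(ltW Ba) // real_exprn_even_ge0 // (Bf_real posF).
rewrite /lam (bigD1_seq a) //= ltr_pwDl ?sumr_ge0 //.
by rewrite divr_gt0 // exprn_gt0.
Qed.

(* The reflection in [a] permutes [s] and negates the coefficient [Bf b a]. *)
Lemma lam_sum a x : a \in s ->
  \sum_(b <- s) Bf b a * (rt h b x : K) = lam a * (rt h a x : K).
Proof.
move=> sa; have Bn0 : Bf a a != 0 by rewrite gt_eqF ?sub_norm_gt0.
have [q qP] : exists q : Q -> int, forall b, b \in s ->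
    2 * Bf a b / Bf a a = (q b)%:~R /\ b - a *~ q b \in s.
  have /choice [q hq] : forall b, exists k : int, b \in s ->
      2 * Bf a b / Bf a a = k%:~R /\ b - a *~ k \in s.
    move=> b; have [sb|nb] := boolP (b \in s); last by exists 0.
    by have [k hk] := sub_refl sa sb; exists k.
  by exists q.
pose r b := b - a *~ q b.
have rs b : b \in s -> r b \in s by move=> /qP [].
have qE b : b \in s -> (q b)%:~R * Bf a a = 2 * Bf a b.
  by move=> /qP [<- _]; rewrite divfK.
have Br b : b \in s -> Bf (r b) a = - Bf b a.
  move=> sb; rewrite /r (BfDl posF) (BfNl posF) (Bfzl posF) qE // (BfC posF a).
  by ring.
have rr b : b \in s -> r (r b) = b.
  move=> sb; have -> : r (r b) = r b - a *~ q (r b) by [].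
  have -> : q (r b) = - q b.
    apply: (@intr_inj K); have := qE _ (rs _ sb).
    rewrite (BfC posF a) Br // mulrN (BfC posF b) -qE // => /eqP.
    by rewrite -mulNr (inj_eq (mulIf Bn0)) -mulrNz => /eqP.
  by rewrite mulrNz opprK addrNK.
have permr : perm_eq s [seq r b | b <- s].
  apply: uniq_perm => //.
    by rewrite map_inj_in_uniq // => b c sb sc bc; rewrite -(rr b) // bc rr.
  move=> b; apply/idP/mapP => [sb|[c sc ->]]; last exact: rs.
  by exists (r b); rewrite ?rr ?rs.
set X := LHS.
have XE : X = - X + 2 * (lam a * (rt h a x : K)).
  rewrite {1}/X (perm_big _ permr) /= big_map /lam mulr_suml mulr_sumr /X -sumrN -big_split /=.
  rewrite big_seq [RHS]big_seq; apply: eq_bigr => b sb.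
  rewrite Br // /r raddfB raddfMz add_lfunE opp_lfunE -scaler_int scale_lfunE.
  have -> : (q b)%:~R *: rt h a x = (2 * Bf a b / Bf a a) * (rt h a x : K).
    by have [-> _] := qP _ sb.
  by rewrite (BfC posF a b); field.
have : X *+ 2 = (lam a * (rt h a x : K)) *+ 2.
  by rewrite mulr2n {1}XE addrAC addNr add0r mulr_natl.
by move/eqP; rewrite eqrMn2r /= => /eqP.
Qed.

(** The averaging operator is self-adjoint, so nonorthogonal eigenvectors share their eigenvalue. *)
Lemma lam_eq a b : a \in s -> b \in s -> Bf a b != 0 -> lam a = lam b.
Proof.
move=> sa sb ab; apply: (mulIf ab).
rewrite {1}(BfC posF a b) -(lam_sum (tt b) sa) -(lam_sum (tt a) sb).
by apply: eq_bigr => c _; rewrite -/(Bf b c) -/(Bf a c) (BfC posF b) (BfC posF a) mulrC.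
Qed.

(** After division by the eigenvalues the averaging operator is the identity on S: the terms not
    orthogonal to a all carry the eigenvalue of a. *)
Lemma lam_dual a x : a \in s ->
  \sum_(b <- s) (lam b)^-1 * (rt h b x : K) * Bf b a = (rt h a x : K).
Proof.
move=> sa; have ln0 : lam a != 0 by rewrite gt_eqF ?lam_gt0.
apply: (mulfI ln0); rewrite -lam_sum // mulr_sumr big_seq [RHS]big_seq.
apply: eq_bigr => b sb; have [->|ba] := eqVneq (Bf b a) 0; first by rewrite mulr0 mul0r mulr0.
by rewrite (lam_eq sb sa ba); field.
Qed.

(** Split c into its projection u on the span of S and a defect on which S vanishes. The defect
    commutes with y, hence is orthogonal to c = [x, y] by invariance, and (c, u) is a sum of real
    squares with positive weights. *)
Lemma sub_coroot_gt0 (c : h) (x y : L) :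
  iota c = lie x y ->
  (forall d, (forall z, z \in s -> rt h z d = 0 :> K) -> lie (iota d) y = 0) ->
  (forall z, z \in s -> (rt h z c : K) \is Num.real) ->
  (exists2 z, z \in s & rt h z c != 0 :> K) ->
  0 < F (iota c) (iota c).
Proof.
move=> cE comm real [z zs zc].
pose u := \sum_(b <- s) ((lam b)^-1 * (rt h b c : K)) *: tt b.
have orth a : a \in s -> rt h a (c - u) = 0 :> K.
  move=> sa; rewrite linearB /u linear_sum /=; apply/eqP; rewrite subr_eq0; apply/eqP.
  rewrite -[LHS](lam_dual c sa); apply: eq_bigr => b _.
  by rewrite linearZ /= -/(Bf b a).
have Fcd : F (iota c) (iota (c - u)) = 0.
  rewrite cE (Finv posF) lieC comm ?oppr0 ?(F0r posF) //.
have -> : F (iota c) (iota c) = \sum_(b <- s) (lam b)^-1 * (rt h b c : K) ^+ 2.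
  rewrite -{2}[c](subrK u) linearD (FDr posF) Fcd add0r /u linear_sum (Fsumr posF) /=.
  apply: eq_bigr => b _; rewrite linearZ /= (FZr posF) (FC posF) (F_tt posF).
  by rewrite -mulrA.
have term b : b \in s -> 0 <= (lam b)^-1 * (rt h b c : K) ^+ 2.
  move=> sb; rewrite mulr_ge0 ?invr_ge0 ?(ltW (lam_gt0 sb)) //.
  by rewrite real_exprn_even_ge0 ?real.
rewrite (bigD1_seq z) //= ltr_pwDl //; last first.
  by rewrite big_seq_cond sumr_ge0 // => b /andP [sb _]; apply: term.
by rewrite mulr_gt0 ?invr_gt0 ?lam_gt0 // real_exprn_even_gt0 ?real.
Qed.

End FiniteSubsystem.

(** * Finite gradations *)

Section MultiplesOfSimple.
Variables (K : numFieldType) (n : nat) (A : 'M[int]_n) (h : realization K A).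
Variables (L : lieAlgType K).

Lemma word_power (g : 'I_n -> L) i s : all (pred1 i) s -> (1 < size s)%N -> word g s = 0.
Proof.
elim: s => // k s IH /= /andP [/eqP -> als] szs.
case: s IH als szs => // l s IH als _.
rewrite -/(word g (l :: s)); case: s IH als => [_ /= /andP [/eqP -> _]|l' s IH als].
  by rewrite lie_alternating.
by rewrite IH ?lie0r.
Qed.

Lemma content_all (i : 'I_n) (s : seq 'I_n) (r : int) : content s = dl i *~ r -> all (pred1 i) s.
Proof.
move=> sr; apply/allP => k ks /=; apply: contraT => ki.
have := contentE s k; rewrite sr -scaler_int !mxE eqxx (negbTE ki) mulr0 => /eqP.
by rewrite eq_sym -has_pred1 in ks *; rewrite has_count in ks; rewrite eqz_nat; move: ks; case: count.
Qed.

Lemma weight_swap (M : kac_moody h L) g x :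
  weight_space (cartan (km_swap M)) g x <-> weight_space (cartan M) (- g) x.
Proof.
split=> wx t; have := wx t; rewrite /= opp_lfunE => wt.
  by rewrite scaleNr -wt lieNl opprK.
by rewrite lieNl wt scaleNr opprK.
Qed.

Lemma weight_multiple_gt0 (M : kac_moody h L) i (r : int) y :
  weight_space (cartan M) (rt h (dl i *~ r)) y -> y != 0 -> 0 < r -> r = 1.
Proof.
move=> wy y0 r0; have z0 : dl i *~ r != 0.
  apply: contraTneq r0 => /rowP /(_ i); rewrite -scaler_int !mxE !eqxx mulr1 intz => ->.
  by rewrite ltxx.
have zz : zge0 (dl i *~ r).
  by apply/zge0P => k; rewrite -scaler_int !mxE intz mulr_ge0 // ltW.
have [s yE] := weight_pos wy z0 zz.
apply: contraNeq y0 => r1; rewrite yE big1 // => u /eqP uE.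
rewrite (@word_power _ i) ?scaler0 //; first exact: content_all uE.
have : ht (content u.2) = r.
  rewrite uE /ht (bigD1 i) //= big1 => [|k ki].
    by rewrite -scaler_int !mxE !eqxx mulr1 addr0 intz.
  by rewrite -scaler_int !mxE eqxx (negbTE ki) mulr0.
rewrite ht_content => sz; have /eqP r1' := r1; move: sz; move: (size u.2) => q; lia.
Qed.

Lemma weight_multiple (M : kac_moody h L) i (r : int) y :
  weight_space (cartan M) (rt h (dl i *~ r)) y -> y != 0 -> r \in [:: 0; 1; -1].
Proof.
move=> wy y0; have [r0|r0|->] := ltrgt0P r; last by rewrite inE eqxx.
  by rewrite (weight_multiple_gt0 wy y0 r0) !inE eqxx.
have : - r = 1.
  apply: (weight_multiple_gt0 (M := km_swap M) (i := i) (y := y)) => //; last by rewrite oppr_gt0.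
  by apply/weight_swap; rewrite mulrNz raddfN opprK.
by move=> r1; rewrite -[r]opprK r1 !inE eqxx !orbT.
Qed.

Lemma chev_neq0 (M : kac_moody h L) i : gcm A -> chev_e M i != 0 /\ chev_f M i != 0.
Proof.
case=> Aii _ _; have := lie_ef M i i; rewrite eqxx => ef.
have c0 : cartan M (simple_coroot h i) != 0.
  apply/eqP; rewrite -(linear0 (cartan M)) => /cartan_inj c0.
  have := rz_pairing h i i; rewrite c0 linear0 Aii => /eqP.
  by rewrite eq_sym pnatr_eq0.
by split; apply: contraNneq c0 => e0; rewrite -ef e0 ?lie0l ?lie0r.
Qed.

(* Vectors of distinct weights are independent, so a finite-dimensional space
   meets only finitely many root spaces. *)
Lemma finite_weights (M : kac_moody h L) (V : L -> Prop) : finite_dimensional V ->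
  exists s : seq 'rV[int]_n, forall z,
    (exists x, [/\ weight_space (cartan M) (rt h z) x, x != 0 & V x]) -> z \in s.
Proof.
case=> d [b [_ Vb]].
pose good z := exists x, [/\ weight_space (cartan M) (rt h z) x, x != 0 & V x].
apply: contrapT => nfin.
have ext (s : seq 'rV[int]_n) : exists z, good z /\ z \notin s.
  apply: contrapT => hn; apply: nfin; exists s => z gz; apply: contraT => zs.
  by case: hn; exists z.
have [s [ss us gs]] : exists s, [/\ size s = d.+1, uniq s & forall z, z \in s -> good z].
  elim: d.+1 => [|k [s [ss us gs]]]; first by exists [::].
  have [z [gz zs]] := ext s; exists (z :: s); rewrite /= ss zs us; split=> // w.
  by rewrite inE => /orP [/eqP ->|/gs].
have /choice [X hX] : forall i : 'I_d.+1, exists x,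
    [/\ weight_space (cartan M) (rt h s`_i) x, x != 0 & V x].
  by move=> i; apply: gs; rewrite mem_nth // ss.
have /choice [cf hcf] : forall i, exists c : 'I_d -> K, X i = \sum_(l < d) c l *: b l.
  by move=> i; apply: Vb; case: (hX i).
(* With one more row than columns, [C] has a nonzero left kernel vector, which is a linear relation
   between vectors of distinct weights. *)
pose C : 'M[K]_(d.+1, d) := \matrix_(i, l) cf i l.
have : kermx C != 0.
  rewrite kermx_eq0 /row_free; apply: contraTneq (rank_leq_col C) => ->.
  by rewrite ltnn.
case/rowV0Pn => u /sub_kermxP uC /eqP u0; apply: u0; apply/rowP => i.
pose t := [seq (rt h s`_(k : 'I_d.+1), u 0 k *: X k) | k <- enum 'I_d.+1].
have wt v : v \in t -> weight_space (cartan M) v.1 v.2.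
  by case/mapP=> k _ -> /=; apply: weightZ; case: (hX k).
have t0 : \sum_(v <- t) v.2 = 0.
  rewrite big_map big_enum /=.
  under eq_bigr => k _ do rewrite hcf scaler_sumr.
  rewrite exchange_big big1 // => l _ /=.
  under eq_bigr => k _ do rewrite scalerA.
  rewrite -scaler_suml.
  have := congr1 (fun D : 'rV_d => D 0 l) uC; rewrite [LHS]mxE [RHS]mxE.
  by under eq_bigr => k _ do rewrite mxE; move=> ->; rewrite scale0r.
have := weight_sum0 wt t0 (rt h s`_i); rewrite big_map big_enum_cond /= (bigD1 i) //=.
rewrite big1 ?addr0 => [/eqP|k /andP [/eqP /rt_inj /eqP + ki]].
  rewrite scaler_eq0 mxE; case: (hX i) => _ /negbTE -> _.
  by rewrite orbF => /eqP.
by rewrite nth_uniq ?ss // => /eqP /val_inj ki'; rewrite ki' eqxx in ki.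
Qed.

End MultiplesOfSimple.

Section Graded.
Variables (K : numFieldType).
Variables (n : nat) (A : 'M[int]_n) (h : realization K A).
Variables (g : lieAlgType K) (Mg : kac_moody h g) (F : g -> g -> K).
Hypotheses (gcmA : gcm A) (posF : positive_form Mg F).
Hypothesis nondeg : forall x, (forall y, F x y = 0) -> x = 0.
Variables (p : nat) (B : 'M[int]_p) (a : realization K B).
Variables (m : lieAlgType K) (Mm : kac_moody a m).
Variables (j : m -> g) (Sigma : 'Hom(a, K^o) -> Prop).
Hypotheses (gcmB : gcm B) (graded : finitely_graded Mg Mm j Sigma).

Local Notation Q := 'rV[int]_n.

Let jlin : linear j. Proof. by case: (fg_morphism graded). Qed.
HB.instance Definition _ := GRing.isLinear.Build K m g *:%R j jlin.
Let jlie x y : j (lie x y) = lie (j x) (j y).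
Proof. by case: (fg_morphism graded) => _ ->. Qed.

Lemma graded_cartan : exists th : 'Hom(a, h), forall t, j (cartan Mm t) = cartan Mg (th t).
Proof.
have /choice [th hth] := fg_cartan graded.
have lth : linear th.
  move=> c u v; apply: (@cartan_inj _ _ _ _ _ Mg).
  by rewrite -hth !linearP /= -!hth.
pose th' : {linear a -> h} := HB.pack th (GRing.isLinear.Build _ _ _ _ th lth).
by exists (linfun th') => t; rewrite lfunE /= hth.
Qed.

Variable k : 'I_p.
Local Notation gam := (simple_root a k).
Local Notation wtm := (weight_space (j \o cartan Mm)).

Let Bkk : B k k = 2. Proof. by case: gcmB. Qed.

Lemma wtm_j d x : weight_space (cartan Mm) d x -> wtm d (j x).
Proof. by move=> wx t; rewrite /= -jlie wx linearZ. Qed.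

Lemma graded_weight d x : wtm d x -> x != 0 -> Sigma d \/ d = 0.
Proof.
move=> wx x0; have [N [ga [v [hv xE]]]] := fg_sum graded x.
pose s := [seq (ga i, v i) | i <- enum 'I_N].
have ws u : u \in s -> wtm u.1 u.2 by case/mapP=> i _ -> /=; case: (hv i).
have xE' : x = \sum_(u <- s) u.2 by rewrite big_map big_enum.
have := weight_proj ws wx xE'; rewrite big_map big_enum_cond /= => xd.
have [i /eqP <-] : exists i, ga i == d.
  apply: contrapT => hn; case/eqP: x0; rewrite xd big_pred0 // => i.
  by apply/negP => gi; apply: hn; exists i.
by case: (hv i).
Qed.

Lemma gam_neq0 : gam != 0.
Proof.
rewrite -rt_dl rt_eq0; apply/eqP => /rowP /(_ k).
by rewrite !mxE !eqxx.
Qed.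

(** Every nonzero weight of the gradation is a root of [m], and a nonzero multiple of a simple root
    is a root only up to sign. So S lives in three finite-dimensional weight spaces of [g]. *)
Lemma graded_multiple (r : int) x : wtm (gam *~ r) x -> x != 0 -> r \in [:: 0; 1; -1].
Proof.
move=> wx x0; have [|r0] := graded_weight wx x0.
  move/(fg_root_system graded) => [_ [y wy y0]].
  apply: (weight_multiple (M := Mm) (i := k) (y := y)) => //.
  by rewrite raddfMz /= rt_dl.
have /eqP : rt a (dl k *~ r) = 0 by rewrite raddfMz /= rt_dl.
rewrite rt_eq0 => /eqP /rowP /(_ k); rewrite -scaler_int !mxE !eqxx mulr1 intz => ->.
by rewrite inE.
Qed.

Lemma graded_finite (r : int) : r \in [:: 0; 1; -1] -> finite_dimensional (wtm (gam *~ r)).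
Proof.
have [e0 f0] := chev_neq0 Mm k gcmB.
rewrite !inE => /or3P [] /eqP ->; apply: (fg_finite graded).
- by right; rewrite mulr0z.
- left; apply/(fg_root_system graded); rewrite mulr1z; split; first exact: gam_neq0.
  by exists (chev_e Mm k) => //; rewrite -rt_dl; exact: weight_e.
- left; apply/(fg_root_system graded); rewrite mulrNz mulr1z; split.
    by rewrite oppr_eq0 gam_neq0.
  by exists (chev_f Mm k) => //; rewrite -rt_dl -raddfN; exact: weight_f.
Qed.

(** Invariance gives (c, c) = (e_k, [f_k, c]) = 2 (e_k, f_k), so positivity is a statement about the
    coroot c, to which averaging over S applies. *)
Lemma graded_eps_gt0 : 0 < F (j (chev_e Mm k)) (j (chev_f Mm k)).
Proof.
have [th hth] := graded_cartan.
pose res z : 'Hom(a, K^o) := (rt h z \o th)%VF.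
have resE z t : res z t = rt h z (th t) by rewrite comp_lfunE.
have wres z x : weight_space (cartan Mg) (rt h z) x -> wtm (res z) x.
  by move=> wx t; rewrite /= hth wx resE.
pose P z := exists r : int, res z = gam *~ r.
have P0 : P 0 by exists 0; apply/lfunP => t; rewrite resE mulr0z raddf0 !zero_lfunE.
have PB y z : P y -> P z -> P (y - z).
  move=> [r yr] [q zq]; exists (r - q); rewrite mulrzBr -yr -zq; apply/lfunP => t.
  by rewrite add_lfunE opp_lfunE !resE raddfB add_lfunE opp_lfunE.
have [s [us sP]] : exists s : seq Q, uniq s /\
    forall z, z \in s <-> [/\ P z, z != 0 & isroot Mg z].
  have [s0 h0] := finite_weights Mg (graded_finite (r := 0) isT).
  have [s1 h1] := finite_weights Mg (graded_finite (r := 1) isT).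
  have [s2 h2] := finite_weights Mg (graded_finite (r := -1) isT).
  exists (undup [seq z <- s0 ++ s1 ++ s2 | `[< [/\ P z, z != 0 & isroot Mg z] >]]).
  split=> [|z]; first exact: undup_uniq.
  rewrite mem_undup mem_filter; split=> [/andP [/asboolP]//|hz].
  apply/andP; split; first exact/asboolP.
  case: hz => -[r zr] _ [x wx x0]; rewrite !mem_cat.
  have wx' : wtm (gam *~ r) x by rewrite -zr; exact: wres.
  have := graded_multiple wx' x0; rewrite !inE => /or3P [] /eqP rE; rewrite rE in wx'.
  - by rewrite h0 //; exists x.
  - by rewrite h1 ?orbT //; exists x.
  - by rewrite h2 ?orbT //; exists x.
(* In the decomposition of v under the Cartan subalgebra of [g], only the components whose weight
   restricts to r times the simple root survive. *)
have decomp (r : int) v : wtm (gam *~ r) v -> exists t : seq (Q * g),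
    v = \sum_(u <- t | res u.1 == gam *~ r) u.2 /\
    forall u, u \in t -> weight_space (cartan Mg) (rt h u.1) u.2.
  move=> wv; have [t [vE wt]] := weight_decomp Mg v; exists t; split=> //.
  pose t' := [seq (res u.1, u.2) | u <- t].
  have wt' u : u \in t' -> wtm u.1 u.2 by case/mapP=> w /wt ww -> /=; apply: wres.
  by rewrite (weight_proj wt' wv) ?big_map.
set c := simple_coroot a k.
have gc : gam c = 2 :> K by rewrite /c rz_pairing Bkk.
have jef : j (cartan Mm c) = lie (j (chev_e Mm k)) (j (chev_f Mm k)).
  by rewrite -jlie lie_ef eqxx.
have : 0 < F (cartan Mg (th c)) (cartan Mg (th c)).
  apply: (sub_coroot_gt0 gcmA posF nondeg P0 PB us sP (x := j (chev_e Mm k)) (y := j (chev_f Mm k))).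
  - by rewrite -hth.
  (* The components of f_k have weight zero or weight in S, so an element of [h] killed by S
     commutes with f_k. *)
  - move=> d hd; have wf : wtm (gam *~ -1) (j (chev_f Mm k)).
      by apply: wtm_j; rewrite mulrNz mulr1z -rt_dl -raddfN; exact: weight_f.
    have [t [-> wt]] := decomp _ _ wf.
    rewrite lie_sumr big_seq_cond big1 // => u /andP [ut /eqP ru].
    rewrite (wt _ ut); have [->|u0] := eqVneq u.2 0; first by rewrite scaler0.
    have [->|z0] := eqVneq u.1 0; first by rewrite raddf0 zero_lfunE scale0r.
    rewrite hd ?scale0r //; apply/sP; split=> //; first by exists (-1).
    by exists u.2 => //; exact: wt.
  - move=> z /sP [[r zr] _ _]; rewrite -resE zr -scaler_int scale_lfunE gc.
    by apply: realM; rewrite ?realz ?realn.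
  (* The vector e_k is nonzero, so it has a nonzero component; the root of that component restricts
     to the simple root and takes the value 2 at c. *)
  - have we : wtm (gam *~ 1) (j (chev_e Mm k)).
      by apply: wtm_j; rewrite mulr1z -rt_dl; exact: weight_e.
    have [t [eE wt]] := decomp _ _ we.
    have [u [ut ru u0]] : exists u, [/\ u \in t, res u.1 = gam *~ 1 & u.2 != 0].
      apply: contrapT => hn; have [/eqP e0 _] := chev_neq0 Mm k gcmB; apply: e0.
      apply: (fg_inj graded); rewrite linear0 eE big_seq_cond big1 // => u /andP [ut /eqP ru].
      by apply: contrapT => /eqP u0; apply: hn; exists u.
    exists u.1; last by rewrite -resE ru mulr1z gc pnatr_eq0.
    apply/sP; split; [by exists 1| |by exists u.2 => //; exact: wt].
    apply: contraNneq gam_neq0 => u10; rewrite -[gam]mulr1z -ru u10.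
    by apply/eqP/lfunP => t'; rewrite resE raddf0 !zero_lfunE.
rewrite -hth {1}jef (Finv posF) -jlie lieC cartan_f gc linearN linearZ /= -scalerN.
by rewrite scaleNr scalerN opprK (FZr posF) pmulr_rgt0.
Qed.

End Graded.

Lemma graded_positive_form (K : numFieldType)
    (n : nat) (A : 'M[int]_n) (h : realization K A)
    (g : lieAlgType K) (Mg : kac_moody h g) (F : g -> g -> K)
    (p : nat) (B : 'M[int]_p) (a : realization K B)
    (m : lieAlgType K) (Mm : kac_moody a m)
    (j : m -> g) (Sigma : 'Hom(a, K^o) -> Prop) :
  gcm A -> positive_form Mg F -> (forall x, (forall y, F x y = 0) -> x = 0) ->
  gcm B -> finitely_graded Mg Mm j Sigma ->
  positive_form Mm (fun x y => F (j x) (j y)).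
Proof.
move=> gA pF nd gB gr; have [lj mj] := fg_morphism gr.
split.
- by move=> x c u v; rewrite lj (pf_linear pF).
- by move=> x y; rewrite (pf_sym pF).
- by move=> x y z; rewrite !mj (pf_inv pF).
- by move=> i; apply: (graded_eps_gt0 gA pF nd gB gr).
Qed.

(** * Nondegeneracy *)

Section Words.
Variables (K : numFieldType) (n : nat) (L : lieAlgType K).
Implicit Types (g : 'I_n -> L) (k : nat).

Definition wordspan g k := lspan (fun y => exists2 s, size s = k & y = word g s).

Lemma wordspan_word g s : wordspan g (size s) (word g s).
Proof. by apply: lspan_in; exists s. Qed.

Lemma wordspan_lie g k i x : (0 < k)%N -> wordspan g k x -> wordspan g k.+1 (lie (g i) x).
Proof.
move=> k0; apply: (lspan_sub (P := fun x => wordspan g k.+1 (lie (g i) x))).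
  exact/submod_lie/lspan_submod.
move=> _ [s sk ->]; apply: lspan_in; exists (i :: s); first by rewrite /= sk.
by rewrite word_cons // -size_eq0 sk -lt0n.
Qed.

Lemma wordspan_sum g k x : wordspan g k x -> exists t : seq (K * seq 'I_n),
  x = \sum_(u <- t) u.1 *: word g u.2 /\ all (fun u => size u.2 == k) t.
Proof.
apply: (lspan_sub (P := fun x => exists t : seq (K * seq 'I_n),
  x = \sum_(u <- t) u.1 *: word g u.2 /\ all (fun u => size u.2 == k) t)); last first.
  by move=> _ [s <- ->]; exists [:: (1, s)]; rewrite big_seq1 scale1r /= eqxx.
split=> [|c _ _ [t [-> kt]] [t' [-> kt']]]; first by exists [::]; rewrite big_nil.
exists ([seq (c * u.1, u.2) | u <- t] ++ t'); rewrite all_cat all_map kt kt' andbT; split=> //.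
by rewrite big_cat big_map scaler_sumr; congr (_ + _); apply: eq_bigr => u _; rewrite scalerA.
Qed.

End Words.

Section Lowering.
Variables (K : numFieldType) (n : nat) (A : 'M[int]_n) (h : realization K A).
Variables (L : lieAlgType K) (M : kac_moody h L).
Notation e := (chev_e M).
Notation f := (chev_f M).

(** A single letter is excluded because its bracket with f_i falls into the Cartan part. *)
Lemma wordspan_lower_word i s : (1 < size s)%N ->
  wordspan e (size s).-1 (lie (f i) (word e s)).
Proof.
elim: s => // k s IH szs; have s0 : s != [::] by case: s szs {IH}.
rewrite word_cons // lie_derivr; apply: lspanD.
  rewrite [lie (f i) _]lieC; have [c ->] := lie_ef_coroot M k i.
  rewrite lieNl (weight_word_e M s); apply: lspanN; apply: lspanZ; exact: wordspan_word.
have [s1|] := ltnP 1 (size s).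
  have := wordspan_lie k _ (IH s1); rewrite -subn1 subn_gt0 => /(_ s1).
  by rewrite subn1 prednK // ltnW.
case: s s0 {IH szs} => // l [|//] _ _ /=.
rewrite [lie (f i) _]lieC; have [c ->] := lie_ef_coroot M l i.
rewrite lieNr [lie (e k) _]lieC cartan_e opprK; apply: lspanZ.
by apply: lspan_in; exists [:: k].
Qed.

Lemma wordspan_lower i k x : (1 < k)%N -> wordspan e k x -> wordspan e k.-1 (lie (f i) x).
Proof.
move=> k1; apply: (lspan_sub (P := fun x => wordspan e k.-1 (lie (f i) x))).
  exact/submod_lie/lspan_submod.
by move=> _ [s sk ->]; rewrite -sk; apply: wordspan_lower_word; rewrite sk.
Qed.

End Lowering.

Section Nondegenerate.
Variables (K : numFieldType) (n : nat) (A : 'M[int]_n) (h : realization K A).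
Variables (L : lieAlgType K).
Hypothesis gcmA : gcm A.

Section Gram.
Variables (M : kac_moody h L) (F : L -> L -> K).
Hypothesis posF : positive_form M F.
Notation iota := (cartan M).
Notation e := (chev_e M).
Notation f := (chev_f M).
Local Notation Bf := (Bf M F).
Local Notation tt := (tt M F).

(** The pairing is graded by word length and not by weight, so that the words of one length are
    indexed by a finite type and have a Gram matrix. *)
Definition nd_at (g g' : 'I_n -> L) k := forall x, wordspan g k x ->
  (forall s, size s = k -> F x (word g' s) = 0) -> x = 0.

Local Notation N k := #|{: k.-tuple 'I_n}|.

Definition wd k (i : 'I_(N k)) : seq 'I_n := tval (enum_val i).
Lemma size_wd k i : size (@wd k i) = k. Proof. by rewrite size_tuple. Qed.
Lemma wd_onto k s : size s = k -> exists i, s = @wd k i.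
Proof.
move=> /eqP sk; exists (enum_rank (Tuple sk)); by rewrite /wd enum_rankK.
Qed.

Definition gram k : 'M[K]_(N k) := \matrix_(i, l) F (word e (wd i)) (word f (wd l)).

(* The pseudo-inverse of the possibly singular Gram matrix yields, modulo the
   kernels of the form, a pair of dual bases in word length [k]. *)
Definition dual_e k (l : 'I_(N k)) : L := \sum_i pinvmx (gram k) l i *: word e (wd i).
Definition dual_f k (l : 'I_(N k)) : L := word f (wd l).

Lemma dual_e_span k l : wordspan e k (@dual_e k l).
Proof.
by apply: lspan_sum => i _; apply: lspanZ; apply: lspan_in; exists (wd i); rewrite ?size_wd.
Qed.
Lemma dual_f_span k l : wordspan f k (@dual_f k l).
Proof. by apply: lspan_in; exists (wd l); rewrite ?size_wd. Qed.

(** Entrywise this is G G' G = G for the Gram matrix G and its pseudo-inverse G'. *)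
Lemma dual_pairing k a b : size a = k -> size b = k ->
  \sum_(l : 'I_(N k)) F (word e a) (dual_f l) * F (dual_e l) (word f b) = F (word e a) (word f b).
Proof.
move=> /wd_onto [i ->] /wd_onto [j ->].
have /matrixP /(_ i j) := mulmxKpV (submx_refl (gram k)).
rewrite mxE [RHS]mxE => <-.
have E l : (gram k *m pinvmx (gram k)) i l = \sum_c gram k i c * pinvmx (gram k) c l by rewrite mxE.
under [RHS]eq_bigr => l _ do rewrite E mulr_suml.
rewrite exchange_big; apply: eq_bigr => l _ /=.
rewrite /dual_e (Fsuml posF) mulr_sumr; apply: eq_bigr => c _.
by rewrite (FZl posF) [gram k i l]mxE [gram k c j]mxE mulrA.
Qed.

(** By [dual_pairing] the two sides pair equally with every word of length k; [nd_at] turns this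
    into equality. *)
Lemma dual_l k y : nd_at e f k -> wordspan e k y ->
  y = \sum_l F y (dual_f l) *: dual_e (k := k) l.
Proof.
move=> nd wy; apply/eqP; rewrite -subr_eq0; apply/eqP; apply: nd.
  apply: lspanD => //; apply: lspanN; apply: lspan_sum => l _; apply: lspanZ; exact: dual_e_span.
move=> b bk; rewrite -scaleN1r (FDl posF) (FZl posF) (Fsuml posF) mulN1r.
apply/eqP; rewrite subr_eq0 eq_sym; apply/eqP.
under eq_bigr => l _ do rewrite (FZl posF).
apply: (lspan_sub (P := fun y => \sum_(l : 'I_(N k)) F y (dual_f l) * F (dual_e l) (word f b) = F y (word f b))) wy.
  split=> [|c u v hu hv].
    by rewrite big1 ?(F0l posF) // => l _; rewrite (F0l posF) mul0r.
  rewrite (FDl posF) (FZl posF) -hu -hv mulr_sumr -big_split; apply: eq_bigr => l _ /=.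
  by rewrite (FDl posF) (FZl posF) mulrDl mulrA.
by move=> _ [a ak ->]; exact: dual_pairing.
Qed.

Lemma dual_r k y : nd_at f e k -> wordspan f k y ->
  y = \sum_l F (dual_e l) y *: dual_f (k := k) l.
Proof.
move=> nd wy; apply/eqP; rewrite -subr_eq0; apply/eqP; apply: nd.
  apply: lspanD => //; apply: lspanN; apply: lspan_sum => l _; apply: lspanZ; exact: dual_f_span.
move=> a ak; rewrite (FC posF) -scaleN1r (FDr posF) (FZr posF) (Fsumr posF) mulN1r.
apply/eqP; rewrite subr_eq0 eq_sym; apply/eqP.
under eq_bigr => l _ do rewrite (FZr posF) mulrC.
apply: (lspan_sub (P := fun y => \sum_(l : 'I_(N k)) F (word e a) (dual_f l) * F (dual_e l) y = F (word e a) y)) wy.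
  split=> [|c u v hu hv].
    by rewrite big1 ?(F0r posF) // => l _; rewrite (F0r posF) mulr0.
  rewrite (FDr posF) (FZr posF) -hu -hv mulr_sumr -big_split; apply: eq_bigr => l _ /=.
  by rewrite (FDr posF) (FZr posF) mulrDr mulrCA.
by move=> _ [b bk ->]; exact: dual_pairing.
Qed.

(** Invariance of the canonical element: the sum of [u_s, e_i] tensor u^s over length l equals the
    sum of u_t tensor [e_i, u^t] over length l + 1. Here it is evaluated on ad u ad v z. *)
Lemma dual_shift l i z : (0 < l)%N -> nd_at e f l.+1 -> nd_at f e l ->
  \sum_s lie (lie (dual_e s) (e i)) (lie (dual_f (k := l) s) z) =
  \sum_t lie (dual_e t) (lie (lie (e i) (dual_f (k := l.+1) t)) z).
Proof.
move=> l0 nd1 nd2.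
have ue s : lie (dual_e s) (e i) =
    \sum_t F (dual_e (k := l) s) (lie (e i) (dual_f t)) *: dual_e (k := l.+1) t.
  rewrite {1}(dual_l (y := lie (dual_e s) (e i)) nd1).
    by apply: eq_bigr => t _; rewrite (Finv posF).
  by rewrite lieC; apply: lspanN; apply: wordspan_lie => //; exact: dual_e_span.
have ev t : lie (e i) (dual_f t) =
    \sum_s F (dual_e s) (lie (e i) (dual_f (k := l.+1) t)) *: dual_f (k := l) s.
  apply: dual_r => //; apply: (wordspan_lower (M := km_swap M) i (k := l.+1)) => //.
  exact: dual_f_span.
under eq_bigr => s _ do rewrite ue lie_suml.
rewrite exchange_big; apply: eq_bigr => t _ /=.
rewrite [in RHS]ev; move: (dual_e t) => u; rewrite lie_suml lie_sumr; apply: eq_bigr => s _.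
by rewrite !lieZl lieZr.
Qed.

(** Length k itself is left out, since dual bases in that length would presuppose the nondegeneracy
    under proof. *)
Definition partial_casimir k (y : L) : L :=
  \sum_(1 <= l < k) \sum_s lie (dual_e s) (lie (dual_f (k := l) s) y).

(** This is 2(rho, z), defined through 2(rho, alpha_i) = (alpha_i, alpha_i) so that no rho has to be
    chosen. *)
Definition rho2 (z : 'rV[int]_n) : K := \sum_i (z 0 i)%:~R * Bf (dl i) (dl i).
Lemma rho2D y z : rho2 (y + z) = rho2 y + rho2 z.
Proof. by rewrite /rho2 -big_split; apply: eq_bigr => i _; rewrite mxE intrD mulrDl. Qed.
Lemma rho2_dl i : rho2 (dl i) = Bf (dl i) (dl i).
Proof.
rewrite /rho2 (bigD1 i) //= big1 => [|k ki]; last by rewrite mxE eqxx (negbTE ki) mul0r.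
by rewrite mxE !eqxx mul1r addr0.
Qed.

(** Induction on the word y = [e_i, z]. Moving e_i out past u^s and then past u_s leaves correction
    terms that telescope across lengths, so that only the lowest and the highest length
    contribute. *)
Lemma casimir_word H : (forall l, (0 < l < H)%N -> nd_at e f l /\ nd_at f e l) ->
  forall s, (0 < size s <= H)%N ->
  partial_casimir (size s) (word e s) =
  (rho2 (content s) - Bf (content s) (content s)) *: word e s.
Proof.
move=> nd; elim=> // i s IH /= szs.
have [->|s0] := eqVneq s [::].
  by rewrite /partial_casimir big_geq // /content big_seq1 rho2_dl subrr scale0r.
rewrite -/(word e (i :: s)) word_cons //; set z := word e s; set y := lie (e i) z.
set k := size s in szs *; have k0 : (0 < k)%N by rewrite lt0n size_eq0.
have kH : (k < H)%N by [].
set ga := content s; have wz : weight_space iota (rt h ga) z by exact: weight_word_e.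
have wy : weight_space iota (rt h (dl i + ga)) y.
  by rewrite raddfD; apply: weight_lie wz; exact: weight_e.
have zv v : size v = k -> lie (word f v) z = - (F z (word f v) *: iota (tt ga)).
  by move=> vk; rewrite lieC (lie_words posF).
have zE : z = \sum_l F z (dual_f l) *: dual_e (k := k) l.
  apply: dual_l; last exact: wordspan_word.
  by case: (nd k); rewrite // k0 kH.
(* By the Leibniz rule [a_] comes from moving e_i past u^s, [b_] from moving it past u_s, and [c_]
   is the Casimir summand acting on z. *)
pose a_ l := \sum_s lie (dual_e s) (lie (lie (dual_f (k := l) s) (e i)) z).
pose b_ l := \sum_s lie (lie (dual_e s) (e i)) (lie (dual_f (k := l) s) z).
pose c_ l := \sum_s lie (dual_e s) (lie (dual_f (k := l) s) z).
have split_abc : partial_casimir k.+1 y =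
    \sum_(1 <= l < k.+1) a_ l + \sum_(1 <= l < k.+1) b_ l + lie (e i) (\sum_(1 <= l < k.+1) c_ l).
  rewrite lie_sumr -!big_split /partial_casimir; apply: eq_bigr => l _ /=.
  rewrite /a_ /b_ /c_ lie_sumr -!big_split; apply: eq_bigr => t _ /=.
  by rewrite /y (lie_derivr (dual_f t)) lieDr (lie_derivr (dual_e t) (e i)) addrA.
have ba l : (0 < l < k)%N -> b_ l = - a_ l.+1.
  move=> /andP [l0 lk]; 
  have [nd1 _] : nd_at e f l.+1 /\ nd_at f e l.+1 by apply: nd; rewrite /= (leq_ltn_trans lk kH).
  have [_ nd2] : nd_at e f l /\ nd_at f e l by apply: nd; rewrite l0 (ltn_trans lk kH).
  rewrite /b_ dual_shift // /a_ -sumrN; apply: eq_bigr => t _.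
  by rewrite (lieC (e i)) lieNl lieNr.
have telescope : \sum_(1 <= l < k.+1) a_ l + \sum_(1 <= l < k.+1) b_ l = a_ 1%N + b_ k.
  rewrite [X in X + _]big_ltn // [X in _ + X]big_nat_recr //= [X in _ + X + _]big_add1 /=.
  have -> : \sum_(1 <= l < k) b_ l = - \sum_(1 <= l < k) a_ l.+1.
    by rewrite -sumrN big_nat [RHS]big_nat; apply: eq_bigr => l; apply: ba.
  by rewrite -addrA; congr (_ + _); rewrite addrA subrr add0r.
have a1 : a_ 1%N = - Bf (dl i) ga *: y.
  have nd1 : nd_at e f 1 by case: (nd 1%N) => //; rewrite /= (leq_ltn_trans k0 kH).
  have eE : e i = \sum_l F (e i) (dual_f l) *: dual_e (k := 1) l.
    by apply: dual_l => //; apply: lspan_in; exists [:: i].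
  rewrite /y [in RHS]eE lie_suml scaler_sumr; apply: eq_bigr => t _.
  have -> : lie (dual_f t) (e i) = - (F (e i) (dual_f t) *: iota (tt (dl i))).
    have := lie_words posF (s := [:: i]) (s' := wd t).
    by rewrite size_wd /content big_seq1 => /(_ erefl) /= <-; rewrite lieC.
  by rewrite lieNl lieZl wz lieNr !lieZr scaleNr lieZl !scalerA mulrC.
have bk : b_ k = - (Bf ga ga + Bf ga (dl i)) *: y.
  have -> : b_ k = - lie (lie z (e i)) (iota (tt ga)).
    rewrite {1}zE !lie_suml -sumrN; apply: eq_bigr => t _.
    by rewrite zv ?size_wd // lieNr lieZr !lieZl.
  rewrite -lieC (lieC z) lieNr wy scaleNr; congr (- (_ *: _)).
  by rewrite raddfD add_lfunE addrC.
(* Going from z to y admits one further length k into the Casimir sum. In this length u^s maps z to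
   the Cartan part, so the summand on z is explicit. *)
have ck : c_ k = Bf ga ga *: z.
  have -> : c_ k = - lie z (iota (tt ga)).
    rewrite {1}zE lie_suml -sumrN; apply: eq_bigr => t _.
    by rewrite zv ?size_wd // lieNr lieZr lieZl.
  by rewrite -lieC wz.
rewrite split_abc telescope a1 bk big_nat_recr //= -/(partial_casimir k z) ck.
rewrite -/k -/ga in IH; rewrite IH; last by rewrite k0 ltnW.
rewrite lieDr !lieZr -/y -!scalerDl content_cons -/ga rho2D rho2_dl.
congr (_ *: _); rewrite !(BfDr, BfDl posF) (BfC posF ga (dl i)); ring.
Qed.

Lemma F_words_size s w : size s != size w -> F (word e s) (word f w) = 0.
Proof.
move=> sw; apply: contraNeq sw => /(F_weight posF (weight_word_e M s) (weight_word_f M w)).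
rewrite -raddfN => /rt_inj /oppr_inj cw.
by rewrite -eqz_nat -!ht_content cw.
Qed.

Lemma F_words_f s w : F (word f s) (word f w) = 0.
Proof.
have [->|s0] := eqVneq s [::]; first exact: F0l posF _.
apply: contraNeq s0 => /(F_weight posF (weight_word_f M s) (weight_word_f M w)).
rewrite -raddfN => /rt_inj cw; rewrite -content_eq0; apply/eqP/zge0_anti; first exact: content_ge0.
have -> : - content s = content w by rewrite -[content w]opprK cw opprK.
exact: content_ge0.
Qed.

Lemma F_cartan_word t w : F (iota t) (word f w) = 0.
Proof.
have [->|w0] := eqVneq w [::]; first exact: F0r posF _.
apply: contraNeq w0 => /(F_weight posF (weight_cartan M t) (weight_word_f M w)).
rewrite -raddfN => /rt_inj /eqP; rewrite oppr0 oppr_eq0 content_eq0; exact.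
Qed.

Lemma nd_step_homogeneous H (b : 'rV[int]_n) y : (1 < H)%N ->
  (forall l, (0 < l < H)%N -> nd_at e f l /\ nd_at f e l) ->
  weight_space iota (rt h b) y -> zge0 b -> b != 0 ->
  partial_casimir H y = (rho2 b - Bf b b) *: y ->
  wordspan e H y -> (forall s, size s = H -> F y (word f s) = 0) -> y = 0.
Proof.
move=> H1 nd wy b0 bn0 cas Hy ky.
have fy i : lie (f i) y = 0.
  have [nd1 _] : nd_at e f H.-1 /\ nd_at f e H.-1 by apply: nd; lia.
  apply: nd1; first exact: wordspan_lower.
  move=> s sH; have s0 : s != [::] by rewrite -size_eq0 sH; lia.
  rewrite lieC (FNl posF) (Finv posF) -word_cons // ky ?oppr0 //= sH prednK //.
  exact: ltnW.
have wfy s : lie (word f s) y = 0.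
  elim: s => [|i s IH]; first exact: lie0l.
  have [->|s0] := eqVneq s [::]; first exact: fy.
  by rewrite word_cons // lie_derivl fy lie0l IH lie0r addr0.
move: cas; rewrite /partial_casimir big1 => [/esym/eqP|l _]; last first.
  by rewrite big1 // => s _; rewrite wfy lie0r.
rewrite scaler_eq0 => /orP [|/eqP //]; rewrite subr_eq0 => /eqP rhoE.
apply/eqP; apply: contraT => y0.
have cle i : ci A i b <= 0.
  have ws : weight_space (cartan (km_swap M)) (rt h (- b)) y.
    by apply/weight_swap; rewrite raddfN opprK.
  have [] := highest_ci gcmA ws y0 (fy i).
  by rewrite raddfN oppr_ge0.
have Ble : Bf b b <= 0.
  rewrite (Bf_suml M F b); apply: sumr_le0 => i _; apply: mulr_ge0_le0.
    by rewrite ler0z; move/zge0P: b0.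
  rewrite Bf_dl; apply: mulr_le0_ge0; first by rewrite lerz0.
  by rewrite invr_ge0 ltW ?(eps_gt0 posF).
have rho_gt0 : 0 < rho2 b.
  have [i bi] : exists i, b 0 i != 0.
    apply: contrapT => hn; case/eqP: bn0; apply/rowP => i; rewrite mxE.
    by apply: contrapT => /eqP bi; apply: hn; exists i.
  have pos k : 0 < Bf (dl k) (dl k).
    by rewrite Bf_dl ci_dl; case: gcmA => -> _ _; rewrite divr_gt0 ?(eps_gt0 posF).
  have bk k : 0 <= b 0 k by move/zge0P: b0.
  rewrite /rho2 (bigD1 i) //=; apply: ltr_pwDl.
    by apply: mulr_gt0 => //; rewrite ltr0z lt_neqAle eq_sym bi bk.
  by apply: sumr_ge0 => k _; rewrite mulr_ge0 ?ler0z // ltW.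
by move: rho_gt0; rewrite rhoE => /lt_le_trans /(_ Ble); rewrite ltxx.
Qed.

(** Length one is direct, e_i and f_i / eps_i being dual. In higher lengths the vector is split into
    weight components, on each of which the Casimir acts by a scalar. *)
Lemma nd_step H : (0 < H)%N ->
  (forall l, (0 < l < H)%N -> nd_at e f l /\ nd_at f e l) -> nd_at e f H.
Proof.
rewrite leq_eqVlt => /orP [/eqP <- _|H1 nd] x wx kx.
  have -> : x = \sum_i (F x (f i) / eps M F i) *: e i.
    apply: (lspan_sub (P := fun x => x = \sum_i (F x (f i) / eps M F i) *: e i)) wx.
      split=> [|c u v {1}-> {1}->].
        by rewrite big1 // => i _; rewrite (F0l posF) mul0r scale0r.
      rewrite scaler_sumr -big_split; apply: eq_bigr => i _ /=.
      by rewrite scalerA -scalerDl (FDl posF) (FZl posF); congr (_ *: _); ring.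
    move=> _ [[|i [|//]] //= _ ->]; rewrite (bigD1 i) //= divff ?(eps_neq0 posF) // scale1r.
    rewrite big1 ?addr0 // => k ki; have -> : F (e i) (f k) = 0; last by rewrite mul0r scale0r.
    apply: contraNeq ki => /(F_weight posF (weight_e M i) (weight_f M k)).
    rewrite -raddfN => /rt_inj /oppr_inj /rowP /(_ k); rewrite !mxE !eqxx /=.
    by case: (k == i).
  by rewrite big1 // => i _; rewrite (kx [:: i]) // mul0r scale0r.
have [t [xE /allP tH]] := wordspan_sum wx.
have -> : x = \sum_(u <- [seq (content u.2, u.1 *: word e u.2) | u <- t]) u.2 by rewrite big_map.
apply: sum_keyed0 => b; rewrite big_map /=; set y := \sum_(u <- t | _) _.
have [[u [ut ub]]|nt] := pselect (exists u, u \in t /\ content u.2 == b); last first.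
  rewrite /y big_seq_cond big_pred0 // => u; apply/negP => /andP [ut ub].
  by apply: nt; exists u.
have wy : weight_space iota (rt h b) y.
  by apply: submod_sum => [|v /eqP <-]; [exact: weight_submod|apply: weightZ; exact: weight_word_e].
have b0 : zge0 b by rewrite -(eqP ub) content_ge0.
have bn0 : b != 0.
  rewrite -(eqP ub) content_eq0 -size_eq0 (eqP (tH _ ut)).
  by rewrite -lt0n ltnW.
apply: (nd_step_homogeneous H1 nd wy b0 bn0).
- rewrite /partial_casimir /y scaler_sumr.
  transitivity (\sum_(v <- t | content v.2 == b) v.1 *: partial_casimir H (word e v.2)).
    rewrite /partial_casimir; under [RHS]eq_bigr => v _ do rewrite scaler_sumr.
    rewrite exchange_big; apply: eq_bigr => l _ /=.
    under [RHS]eq_bigr => v _ do rewrite scaler_sumr.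
    rewrite exchange_big; apply: eq_bigr => s _ /=.
    by rewrite !lie_sumr; apply: eq_bigr => v _; rewrite !lieZr.
  rewrite big_seq_cond [RHS]big_seq_cond; apply: eq_bigr => v /andP [vt /eqP <-].
  rewrite -{1}(eqP (tH _ vt)) (casimir_word nd) ?(eqP (tH _ vt)) ?leqnn ?andbT ?(ltnW H1) //.
  by rewrite !scalerA mulrC.
- rewrite /y big_seq_cond; apply: lspan_sum => v /andP [vt _]; apply: lspanZ.
  by rewrite -(eqP (tH _ vt)); exact: wordspan_word.
(* A word of content b sees only the component of weight b, so the orthogonality of x passes to the
   component; other words are orthogonal to it by weight. *)
- move=> s sH; have [sb|sb] := eqVneq (content s) b.
    rewrite -[RHS](kx s sH) xE (Fsuml posF) (Fsuml posF) [RHS](bigID (fun v => content v.2 == b)) /=.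
    rewrite [X in _ = _ + X]big1 ?addr0 // => v vb; rewrite (FZl posF).
    suff -> : F (word e v.2) (word f s) = 0 by rewrite mulr0.
    apply: contraNeq vb => /(F_weight posF (weight_word_e M _) (weight_word_f M s)).
    by rewrite -raddfN => /rt_inj /oppr_inj <-; rewrite sb.
  apply: contraNeq sb => /(F_weight posF wy (weight_word_f M s)).
  by rewrite -raddfN => /rt_inj /oppr_inj ->.
Qed.

(** A negative word of length k pairs only with positive words of length k, so the positive part of
    a vector in the radical vanishes length by length. *)
Lemma kernel_word_part t (se sf : seq (K * seq 'I_n)) :
  (forall k, (0 < k)%N -> nd_at e f k) ->
  (forall y, F (iota t + \sum_(u <- se) u.1 *: word e u.2 + \sum_(u <- sf) u.1 *: word f u.2) y = 0) ->
  \sum_(u <- se) u.1 *: word e u.2 = 0.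
Proof.
move=> nd kx.
have -> : \sum_(u <- se) u.1 *: word e u.2 = \sum_(v <- [seq (size u.2, u.1 *: word e u.2) | u <- se]) v.2.
  by rewrite big_map.
apply: sum_keyed0 => k; rewrite big_map /=.
case: k => [|k].
  by rewrite big1 // => u; rewrite size_eq0 => /eqP ->; rewrite scaler0.
apply: (nd k.+1) => // [|s sk].
  by apply: lspan_sum => u /eqP <-; apply: lspanZ; exact: wordspan_word.
have := kx (word f s); rewrite !(FDl posF) F_cartan_word add0r.
rewrite (Fsuml posF) (Fsuml posF) [X in _ + X]big1 ?addr0 => [H|u _]; last first.
  by rewrite (FZl posF) F_words_f mulr0.
rewrite (Fsuml posF) -[RHS]H [RHS](bigID (fun u => size u.2 == k.+1)) /=.
rewrite [X in _ = _ + X]big1 ?addr0 // => u uk.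
by rewrite (FZl posF) F_words_size ?mulr0 // sk.
Qed.

End Gram.

(* Both kernels of the pairing between word lengths [k] and [-k] vanish, by
   induction on [k]; the two sides are exchanged by the Chevalley involution. *)
Theorem positive_form_nondegenerate (M : kac_moody h L) F :
  positive_form M F -> forall x, (forall y, F x y = 0) -> x = 0.
Proof.
move=> posF; have posF' := positive_form_swap posF.
have nd k : (0 < k)%N -> nd_at F (chev_e M) (chev_f M) k /\ nd_at F (chev_f M) (chev_e M) k.
  elim/ltn_ind: k => k IH k0; split.
    apply: (nd_step posF) => // l /andP [l0 lk]; exact: IH.
  apply: (nd_step posF') => // l /andP [l0 lk] /=.
  by have [] := IH l lk l0.
move=> x kx; have [t [se [sf xE]]] := triang_decomp M x.
have se0 : \sum_(u <- se) u.1 *: word (chev_e M) u.2 = 0.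
  apply: (kernel_word_part posF (t := t) (sf := sf)) => [k k0|y]; first by case: (nd k k0).
  by rewrite -xE.
have sf0 : \sum_(u <- sf) u.1 *: word (chev_f M) u.2 = 0.
  apply: (kernel_word_part posF' (t := - t) (se := sf) (sf := se)) => [k k0|y] /=.
    by case: (nd k k0).
  by rewrite linearN opprK addrAC -xE.
rewrite xE se0 sf0 !addr0 in kx *.
by rewrite (cartan_nondeg posF (t := t)) ?linear0 // => s; apply: kx.
Qed.

End Nondegenerate.

(** The symmetric matrix is that of the numbers (alpha_i, alpha_j) = a_ij / eps_i. *)
Lemma positive_form_symmetrizable (K : numFieldType) (n : nat) (A : 'M[int]_n)
    (h : realization K A) (L : lieAlgType K) (M : kac_moody h L) (F : L -> L -> K) :
  positive_form M F -> symmetrizable K A.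
Proof.
move=> posF; exists (diag_mx (\row_i (eps M F i)^-1)); split.
- exact: diag_mx_is_diag.
- rewrite unitmxE det_diag unitfE; apply/prodf_neq0 => i _.
  by rewrite mxE invr_eq0 (eps_neq0 posF).
apply/matrixP => i j; rewrite !mul_diag_mx !mxE.
by have := BfC posF (dl j) (dl i); rewrite !Bf_dl !ci_dl mulrC => ->; rewrite mulrC.
Qed.

(** Again (c, c) = 2 (e_i, f_i) for the i-th coroot c, and the normalisation makes (c, c) a positive
    rational. *)
Lemma invariant_form_positive (K : numFieldType) (n : nat) (A : 'M[int]_n)
    (h : realization K A) (L : lieAlgType K) (M : kac_moody h L) (F : L -> L -> K) :
  gcm A -> invariant_form M F -> positive_form M F.
Proof.
move=> [Aii _ _] invF; split; [exact: form_linear invF|exact: form_sym invF|exact: form_invariant invF|].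
move=> i; have [q q0 /=] := form_coroot_pos invF i.
have := lie_ef M i i; rewrite eqxx => ef.
rewrite -{1}ef (form_invariant invF) lieC cartan_f rz_pairing Aii scaleNr opprK.
have -> : F (chev_e M i) ((2%:Z)%:~R *: chev_f M i) = 2 * F (chev_e M i) (chev_f M i).
  by have := form_linear invF (chev_e M i) 2 (chev_f M i) 0; rewrite addr0 => ->;
     have := form_linear invF (chev_e M i) (-1) 0 0; rewrite scaler0 addr0 mulN1r addNr => ->; rewrite addr0.
by move=> qE; rewrite -(pmulr_rgt0 _ (ltr0n K 2)) qE ltr0q.
Qed.

Theorem corollary3p16 (R : realType)
    (n : nat) (A : 'M[int]_n) (h : realization R[i] A)
    (g : lieAlgType R[i]) (Mg : kac_moody h g) (form : g -> g -> R[i])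
    (p : nat) (B : 'M[int]_p) (a : realization R[i] B)
    (m : lieAlgType R[i]) (Mm : kac_moody a m)
    (j : m -> g) (Sigma : 'Hom(a, R[i]^o) -> Prop)
    (gcmA : gcm A) (indecA : indecomposable A) (symA : symmetrizable R[i] A)
    (form_inv : invariant_form Mg form)
    (gcmB : gcm B) (indecB : indecomposable B)
    (graded : finitely_graded Mg Mm j Sigma) :
  symmetrizable R[i] B /\
  (forall x : m, (forall y : m, form (j x) (j y) = 0) -> x = 0).
Proof.
have posg := invariant_form_positive gcmA form_inv.
have posm := graded_positive_form gcmA posg (form_nondegenerate form_inv) gcmB graded.
split; first exact: positive_form_symmetrizable posm.
exact: positive_form_nondegenerate gcmB _ _ posm.
Qed.
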